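(* Let $0\le\alpha<1$ and let $f(z)=zh(z)\overline{g(z)}$ belong to $\mathcal{S}^{*}_{Lh}(\alpha)$, where $$h(z)=\exp\left(\sum_{n=1}^{\infty}a_nz^n\right),\qquad g(z)=\exp\left(\sum_{n=1}^{\infty}b_nz^n\right)\qquad(z\in\mathbb{D}).$$ Then $$|a_n-b_n|\le\frac{2(1-\alpha)}{n}\quad\text{for all } n\ge 1.$$ Equality holds if $f=f_\alpha$ or $f$ is one of the rotations $z\mapsto\overline{\eta}f_\alpha(\eta z)$, $|\eta|=1$, of $f_\alpha$, where $$f_\alpha(z)=\frac{z}{(1-z)^{2(1-\alpha)}}\left|(1-z)^{1-2\alpha}\exp\left(2(1-\alpha)\frac{z}{1-z}\right)\right|^2.$$
   Context: $\mathbb{D}$ is the open unit disk in $\mathbb{C}$. A log-harmonic mapping on $\mathbb{D}$ is a solution $f$ of $$\overline{f_{\overline{z}}(z)}=\mu(z)\left(\frac{\overline{f(z)}}{f(z)}\right)f_z(z)$$ for some analytic $\mu:\mathbb{D}\to\mathbb{C}$ with $|\mu(z)|<1$ on $\mathbb{D}$. For $f=zh\overline{g}$ with $h,g$ analytic and non-vanishing, the dilatation is $\mu(z)=\dfrac{zg'(z)/g(z)}{1+zh'(z)/h(z)}$. $\mathcal{S}_{Lh}$ is the class of univalent (injective) log-harmonic mappings $f(z)=zh(z)\overline{g(z)}$ on $\mathbb{D}$ with $h,g$ analytic in $\mathbb{D}$, $h(0)=g(0)=1$, of the form $h=\exp(\sum_{n\ge1}a_nz^n)$, $g=\exp(\sum_{n\ge1}b_nz^n)$.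 For $\alpha\in[0,1)$, $\mathcal{S}^{*}_{Lh}(\alpha)$ (starlike log-harmonic mappings of order $\alpha$) is the set of $f\in\mathcal{S}_{Lh}$ with $$\operatorname{Re}\left(\frac{zf_z(z)-\overline{z}f_{\overline{z}}(z)}{f(z)}\right)>\alpha\quad\text{for all } z\in\mathbb{D}\setminus\{0\}.$$ Powers of $1-z$ are principal branches. The function $f_\alpha$ corresponds to $g(z)=(1-z)^{1-2\alpha}\exp\left(2(1-\alpha)\frac{z}{1-z}\right)$ and $h(z)=\frac{1}{1-z}\exp\left(2(1-\alpha)\frac{z}{1-z}\right)$; its rotation $\overline{\eta}f_\alpha(\eta z)$ corresponds to $h(\eta z)$, $g(\eta z)$. *)

(* Defs.v *)
From Stdlib Require Import Reals.
From Coquelicot Require Import Coquelicot.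

Open Scope R_scope.

Definition in_disk (z : C) : Prop := Cmod z < 1.

Definition analytic_on_disk (h : C -> C) : Prop :=
  forall z : C, in_disk z -> ex_derive (K := C_AbsRing) (V := C_NormedModule) h z.

Definition univalent_on_disk (f : C -> C) : Prop :=
  forall z w : C, in_disk z -> in_disk w -> f z = f w -> z = w.

Definition Cexp (z : C) : C :=
  (exp (Re z) * cos (Im z), exp (Re z) * sin (Im z)).

(** Principal argument, in (-PI, PI]; only meaningful for [w <> 0]. *)
Definition Carg (w : C) : R :=
  if Rle_dec 0 (Im w) then acos (Re w / Cmod w) else - acos (Re w / Cmod w).

Definition Clog (w : C) : C := (ln (Cmod w), Carg w).

Definition Cpower (w : C) (c : R) : C := Cexp (RtoC c * Clog w)%C.

Definition partial_x (f : C -> C) (z : C) : C :=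
  (Derive (fun t : R => Re (f (t, Im z))) (Re z),
   Derive (fun t : R => Im (f (t, Im z))) (Re z)).

Definition partial_y (f : C -> C) (z : C) : C :=
  (Derive (fun t : R => Re (f (Re z, t))) (Im z),
   Derive (fun t : R => Im (f (Re z, t))) (Im z)).

Definition d_z (f : C -> C) (z : C) : C :=
  ((partial_x f z - Ci * partial_y f z) / 2)%C.

Definition d_zbar (f : C -> C) (z : C) : C :=
  ((partial_x f z + Ci * partial_y f z) / 2)%C.

(** Differentiability as a map of the real plane: [Derive] is total, so that
    the equation alone would not say that the partial derivatives exist. *)
Definition real_differentiable_on_disk (f : C -> C) : Prop :=
  forall z : C, in_disk z ->
    ex_filterdiff (K := R_AbsRing) (U := C_R_NormedModule) (V := C_R_NormedModule)
      f (locally z).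

(** The equation is only meaningful where [f] does not vanish. *)
Definition log_harmonic (f : C -> C) : Prop :=
  real_differentiable_on_disk f /\
  exists mu : C -> C,
    analytic_on_disk mu /\
    (forall z : C, in_disk z -> Cmod (mu z) < 1) /\
    (forall z : C, in_disk z -> f z <> RtoC 0 ->
       Cconj (d_zbar f z) = (mu z * (Cconj (f z) / f z) * d_z f z)%C).

(** [h z = exp (a_1 z + a_2 z^2 + ...)] on the disk, the series being convergent
    there; the value [a 0] is irrelevant. *)
Definition exp_power_series (h : C -> C) (a : nat -> C) : Prop :=
  forall z : C, in_disk z ->
    exists s : C,
      is_series (K := C_AbsRing) (V := C_NormedModule)
        (fun n : nat => (a (S n) * z ^ (S n))%C) s /\
      h z = Cexp s.

Definition log_harmonic_rep (f h g : C -> C) (a b : nat -> C) : Prop :=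
  analytic_on_disk h /\ analytic_on_disk g /\
  h (RtoC 0) = RtoC 1 /\ g (RtoC 0) = RtoC 1 /\
  exp_power_series h a /\ exp_power_series g b /\
  (forall z : C, in_disk z -> f z = (z * h z * Cconj (g z))%C).

Definition S_Lh (f : C -> C) : Prop :=
  log_harmonic f /\ univalent_on_disk f /\
  exists (h g : C -> C) (a b : nat -> C), log_harmonic_rep f h g a b.

Definition S_Lh_star (alpha : R) (f : C -> C) : Prop :=
  S_Lh f /\
  forall z : C, in_disk z -> z <> RtoC 0 ->
    Re ((z * d_z f z - Cconj z * d_zbar f z) / f z)%C > alpha.

Definition f_extremal (alpha : R) (z : C) : C :=
  (z / Cpower (1 - z) (2 * (1 - alpha)) *
   RtoC (Cmod (Cpower (1 - z) (1 - 2 * alpha) *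
               Cexp (RtoC (2 * (1 - alpha)) * (z / (1 - z)))) ^ 2))%C.

Definition extremal_or_rotation (alpha : R) (f : C -> C) : Prop :=
  (forall z : C, in_disk z -> f z = f_extremal alpha z) \/
  (exists eta : C, Cmod eta = 1 /\
     forall z : C, in_disk z -> f z = (Cconj eta * f_extremal alpha (eta * z))%C).

(* Main.v *)
Require Import Defs.
From Stdlib Require Import Reals Lra Lia.
From Coquelicot Require Import Coquelicot.

Open Scope R_scope.

(** Write f(z) = z exp(A(z)) conj(exp(B(z))) with A = sum a_n z^n and
    B = sum b_n z^n. Since A and B are holomorphic, f_z and f_zbar can be read
    off this formula and
      Re ((z f_z - conj z f_zbar) / f) = 1 + Re (z A' - z B')
                                       = 1 + Re (sum n (a_n - b_n) z^n).
    Starlikeness of order alpha thus says that the holomorphic function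
    q = sum n (a_n - b_n) z^n, which vanishes at 0, satisfies
    Re q > -(1 - alpha). Caratheodory's inequality ([coefficient_bound]) gives
    n |a_n - b_n| <= 2 (1 - alpha). It is proved by integrating, over a circle,
    a partial sum of the series against the nonnegative kernel
    1 + cos (n t + phi).

    The left-hand side above depends on f alone. Hence two representations of
    the same f give functions q with equal real parts, and
    [coefficient_bound], applied to their difference with an arbitrarily small
    bound, shows that a_n - b_n is determined by f
    ([coefficient_difference_unique]). Equality for the extremal functions
    therefore has to be checked on one representation only, the one with
      a_n = (1/n + 2 (1 - alpha)) eta^n,
      b_n = (- (1 - 2 alpha)/n + 2 (1 - alpha)) eta^n,
    for which a_n - b_n = 2 (1 - alpha) eta^n / n. It comes from the series of
    -log (1 - w) and w / (1 - w) at w = eta z. The same coefficients show that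
    the dilatation is eta z and that the angular derivative is
    1 + 2 (1 - alpha) Re (w / (1 - w)) > alpha.

    What remains is that f_alpha is injective. Put kappa = 2 (1 - alpha). Then
      arg f_alpha(z) = arg z - kappa arg (1 - z).
    On the upper half disk take gamma = arg z and delta = - arg (1 - z), the
    angles at 0 and 1 of the triangle 0, 1, z, as coordinates: the half disk
    becomes the convex set gamma > 0, delta > 0, gamma + 2 delta < PI, and
    the level sets of arg f_alpha become segments gamma + kappa delta = const.
    Along such a segment |f_alpha| is strictly increasing
    ([log_radius_increasing]), because the derivative of log |f_alpha| is
    Re ((1 + z)/(1 - z)) times a quadratic in kappa without real zeros. So
    modulus and argument of f_alpha(z) determine z. The lower half disk follows
    by conjugation, the real diameter by monotonicity, and the sign of
    Im f_alpha(z) separates the three pieces. *)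

(** * First-order expansions in the Wirtinger sense *)

(** The remainder class o(|k|) at the origin. *)
Definition negligible (r : C -> C) : Prop :=
  forall eps : R, 0 < eps ->
  exists delta : R, 0 < delta /\
    forall k : C, Cmod k < delta -> Cmod (r k) <= eps * Cmod k.

Definition lipschitz_at_0 (u : C -> C) : Prop :=
  exists M delta : R, 0 <= M /\ 0 < delta /\
    forall k : C, Cmod k < delta -> Cmod (u k) <= M * Cmod k.

Lemma negligible_ext (r s : C -> C) :
  (forall k, r k = s k) -> negligible r -> negligible s.
Proof.
  intros E H eps He; destruct (H eps He) as [d [Hd Hk]].
  exists d; split; auto; intros k Hlt; rewrite <- E; auto.
Qed.

Lemma negligible_plus (r s : C -> C) :
  negligible r -> negligible s -> negligible (fun k => r k + s k)%C.
Proof.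
  intros Hr Hs eps He.
  destruct (Hr (eps / 2)) as [d1 [Hd1 H1]]; [lra|].
  destruct (Hs (eps / 2)) as [d2 [Hd2 H2]]; [lra|].
  exists (Rmin d1 d2); split; [now apply Rmin_pos|].
  intros k Hk.
  assert (Hk1 := H1 k (Rlt_le_trans _ _ _ Hk (Rmin_l _ _))).
  assert (Hk2 := H2 k (Rlt_le_trans _ _ _ Hk (Rmin_r _ _))).
  eapply Rle_trans; [apply Cmod_triangle|lra].
Qed.

Lemma negligible_scal (c : C) (r : C -> C) :
  negligible r -> negligible (fun k => c * r k)%C.
Proof.
  intros Hr eps He.
  assert (Hc := Cmod_ge_0 c).
  destruct (Hr (eps / (Cmod c + 1))) as [d [Hd H]].
  { apply Rdiv_lt_0_compat; lra. }
  exists d; split; auto; intros k Hk.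
  rewrite Cmod_mult.
  apply Rle_trans with (Cmod c * (eps / (Cmod c + 1) * Cmod k)).
  - apply Rmult_le_compat_l; auto.
  - replace (Cmod c * (eps / (Cmod c + 1) * Cmod k))
      with ((eps * Cmod k) * (Cmod c / (Cmod c + 1))) by (field; lra).
    rewrite <- (Rmult_1_r (eps * Cmod k)) at 2.
    apply Rmult_le_compat_l.
    + apply Rmult_le_pos; [lra|apply Cmod_ge_0].
    + apply Rmult_le_reg_r with (Cmod c + 1); [lra|].
      unfold Rdiv; rewrite Rmult_assoc, Rinv_l; lra.
Qed.

Lemma negligible_mult (u v : C -> C) :
  lipschitz_at_0 u -> lipschitz_at_0 v -> negligible (fun k => u k * v k)%C.
Proof.
  intros [M [d1 [HM [Hd1 H1]]]] [N [d2 [HN [Hd2 H2]]]] eps He.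
  assert (Hp : 0 < eps / (M * N + 1)).
  { apply Rdiv_lt_0_compat; nra. }
  exists (Rmin (Rmin d1 d2) (eps / (M * N + 1))); split.
  { repeat apply Rmin_pos; auto. }
  intros k Hk.
  assert (Hmin := Rmin_l (Rmin d1 d2) (eps / (M * N + 1))).
  assert (Hmin' := Rmin_r (Rmin d1 d2) (eps / (M * N + 1))).
  assert (A := Rmin_l d1 d2); assert (B := Rmin_r d1 d2).
  assert (Hk1 : Cmod (u k) <= M * Cmod k) by (apply H1; lra).
  assert (Hk2 : Cmod (v k) <= N * Cmod k) by (apply H2; lra).
  assert (K0 := Cmod_ge_0 k).
  rewrite Cmod_mult.
  apply Rle_trans with ((M * Cmod k) * (N * Cmod k)).
  { apply Rmult_le_compat; auto using Cmod_ge_0. }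
  replace (M * Cmod k * (N * Cmod k)) with ((M * N * Cmod k) * Cmod k) by ring.
  apply Rmult_le_compat_r; auto.
  apply Rle_trans with ((M * N + 1) * Cmod k); [nra|].
  apply Rle_trans with ((M * N + 1) * (eps / (M * N + 1))).
  - apply Rmult_le_compat_l; [nra|lra].
  - right; field; nra.
Qed.

(** This is what makes the chain rule work: the inner increment is itself
    of size O(|k|). *)
Lemma negligible_comp (r m : C -> C) :
  negligible r -> lipschitz_at_0 m -> negligible (fun k => r (m k)).
Proof.
  intros Hr [M [d [HM [Hd Hm]]]] eps He.
  destruct (Hr (eps / (M + 1))) as [d' [Hd' H]].
  { apply Rdiv_lt_0_compat; lra. }
  exists (Rmin d (d' / (M + 1))); split.
  { apply Rmin_pos; auto. apply Rdiv_lt_0_compat; lra. }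
  intros k Hk.
  assert (A := Rmin_l d (d' / (M + 1))); assert (B := Rmin_r d (d' / (M + 1))).
  assert (K0 := Cmod_ge_0 k).
  assert (Hmk : Cmod (m k) <= M * Cmod k) by (apply Hm; lra).
  assert (Hlt : (M + 1) * Cmod k < d').
  { replace d' with ((M + 1) * (d' / (M + 1))) by (field; lra).
    apply Rmult_lt_compat_l; lra. }
  eapply Rle_trans; [apply H; lra|].
  apply Rle_trans with (eps / (M + 1) * ((M + 1) * Cmod k)).
  - apply Rmult_le_compat_l; [apply Rlt_le, Rdiv_lt_0_compat|]; lra.
  - right; field; lra.
Qed.

Lemma negligible_quadratic (r : C -> C) (K d : R) :
  0 < d -> (forall k, Cmod k < d -> Cmod (r k) <= K * Cmod k ^ 2) -> negligible r.
Proof.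
  intros Hd H eps He.
  assert (Hp : 0 < eps / (Rabs K + 1)).
  { apply Rdiv_lt_0_compat; [lra|]; assert (T := Rabs_pos K); lra. }
  exists (Rmin d (eps / (Rabs K + 1))); split; [now apply Rmin_pos|].
  intros k Hk.
  assert (A := Rmin_l d (eps / (Rabs K + 1))); assert (B := Rmin_r d (eps / (Rabs K + 1))).
  eapply Rle_trans; [apply H; lra|].
  assert (K0 := Cmod_ge_0 k); assert (T := Rabs_pos K); assert (T' := Rle_abs K).
  replace (K * Cmod k ^ 2) with ((K * Cmod k) * Cmod k) by ring.
  apply Rmult_le_compat_r; auto.
  apply Rle_trans with ((Rabs K + 1) * Cmod k); [nra|].
  apply Rle_trans with ((Rabs K + 1) * (eps / (Rabs K + 1))).
  - apply Rmult_le_compat_l; lra.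
  - right; field; lra.
Qed.

(** Real differentiability of [f] at [z], with the real-linear differential
    written as P k + Q conj k, so that P and Q are the two Wirtinger
    derivatives. The case Q = 0 is complex differentiability; one calculus then
    serves both the holomorphic factors and their products with conjugates. *)
Definition is_wirt (f : C -> C) (z P Q : C) : Prop :=
  negligible (fun k => f (z + k) - f z - (P * k + Q * Cconj k))%C.

Lemma is_wirt_lipschitz (f : C -> C) (z P Q : C) :
  is_wirt f z P Q -> lipschitz_at_0 (fun k => f (z + k) - f z)%C.
Proof.
  intros H; destruct (H 1 Rlt_0_1) as [d [Hd Hk]].
  exists (1 + Cmod P + Cmod Q), d.
  assert (HP := Cmod_ge_0 P); assert (HQ := Cmod_ge_0 Q).
  repeat split; [lra|auto|].
  intros k Hlt; specialize (Hk k Hlt).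
  replace (f (z + k) - f z)%C with
    ((f (z + k) - f z - (P * k + Q * Cconj k)) + (P * k + Q * Cconj k))%C by ring.
  eapply Rle_trans; [apply Cmod_triangle|].
  assert (T := Cmod_triangle (P * k) (Q * Cconj k)).
  rewrite !Cmod_mult, Cmod_conj in T. lra.
Qed.

Lemma is_wirt_ext_disk (f g : C -> C) (z P Q : C) :
  in_disk z -> (forall w, in_disk w -> f w = g w) ->
  is_wirt f z P Q -> is_wirt g z P Q.
Proof.
  unfold in_disk; intros Hz E H eps He; destruct (H eps He) as [d [Hd Hk]].
  exists (Rmin d (1 - Cmod z)); split; [apply Rmin_pos; lra|].
  intros k Hlt.
  assert (A := Rmin_l d (1 - Cmod z)); assert (B := Rmin_r d (1 - Cmod z)).
  assert (T := Cmod_triangle z k).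
  rewrite <- !E; [apply Hk|..]; lra.
Qed.

Lemma is_wirt_eq (f : C -> C) (z P Q P' Q' : C) :
  is_wirt f z P Q -> P = P' -> Q = Q' -> is_wirt f z P' Q'.
Proof. intros; subst; auto. Qed.

Lemma negligible_0 : negligible (fun _ => RtoC 0).
Proof.
  intros eps He; exists 1; split; [lra|]; intros k _.
  rewrite Cmod_0; apply Rmult_le_pos; [lra|apply Cmod_ge_0].
Qed.

Lemma is_wirt_id (z : C) : is_wirt (fun w => w) z 1 0.
Proof. eapply negligible_ext; [|apply negligible_0]; intros k; simpl; ring. Qed.

Lemma is_wirt_const (c z : C) : is_wirt (fun _ => c) z 0 0.
Proof. eapply negligible_ext; [|apply negligible_0]; intros k; simpl; ring. Qed.

Lemma is_wirt_conj (f : C -> C) (z P Q : C) :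
  is_wirt f z P Q -> is_wirt (fun w => Cconj (f w)) z (Cconj Q) (Cconj P).
Proof.
  intros H eps He; destruct (H eps He) as [d [Hd Hk]].
  exists d; split; auto; intros k Hlt.
  rewrite <- Cmod_conj; eapply Rle_trans; [|apply Hk, Hlt].
  right; f_equal.
  rewrite !Cminus_conj, Cplus_conj, !Cmult_conj, !Cconj_conj; ring.
Qed.

(** The product of the two increments is the only second-order term, and
    it is negligible because each increment is O(|k|). *)
Lemma is_wirt_mult (f g : C -> C) (z P Q P' Q' : C) :
  is_wirt f z P Q -> is_wirt g z P' Q' ->
  is_wirt (fun w => f w * g w)%C z (P * g z + f z * P') (Q * g z + f z * Q').
Proof.
  intros H H'.
  eapply negligible_ext;
    [|apply (negligible_plus _ _
        (negligible_plus _ _ (negligible_scal (g z) _ H) (negligible_scal (f z) _ H'))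
        (negligible_mult _ _ (is_wirt_lipschitz _ _ _ _ H)
           (is_wirt_lipschitz _ _ _ _ H')))].
  intros k; simpl; ring.
Qed.

Lemma Cexp_plus (u v : C) : Cexp (u + v) = (Cexp u * Cexp v)%C.
Proof.
  unfold Cexp, Cmult; destruct u as [a b], v as [c d]; simpl.
  rewrite exp_plus, cos_plus, sin_plus; f_equal; ring.
Qed.

Lemma Cmod_Cexp (u : C) : Cmod (Cexp u) = exp (Re u).
Proof.
  unfold Cmod, Cexp; simpl.
  replace (_ + _) with ((exp (Re u))²).
  - apply sqrt_Rsqr, Rlt_le, exp_pos.
  - assert (T := sin2_cos2 (Im u)); unfold Rsqr in *.
    transitivity (exp (Re u) * exp (Re u) * (sin (Im u) * sin (Im u) + cos (Im u) * cos (Im u)));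
      [rewrite T; ring|ring].
Qed.

Lemma Cexp_neq_0 (u : C) : Cexp u <> RtoC 0.
Proof.
  intros E; assert (T := Cmod_Cexp u); rewrite E, Cmod_0 in T.
  assert (P := exp_pos (Re u)); lra.
Qed.

Lemma real_deriv_bound (f : R -> R) (l eps : R) :
  is_derive f 0 l -> 0 < eps ->
  exists d, 0 < d /\ forall x, Rabs x < d -> Rabs (f x - f 0 - l * x) <= eps * Rabs x.
Proof.
  intros H He; apply is_derive_Reals in H.
  destruct (H eps He) as [d Hd]; exists d; split; [apply cond_pos|].
  intros x Hx; destruct (Req_dec x 0) as [->|Hx0].
  - replace (f 0 - f 0 - l * 0) with 0 by ring; rewrite Rabs_R0; lra.
  - specialize (Hd x Hx0 Hx); rewrite Rplus_0_l in Hd.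
    replace (f x - f 0 - l * x) with (((f x - f 0) / x - l) * x) by (field; auto).
    rewrite Rabs_mult; apply Rmult_le_compat_r; [apply Rabs_pos|lra].
Qed.

Lemma Cmod_le_abs (z : C) : Cmod z <= Rabs (Re z) + Rabs (Im z).
Proof.
  unfold Cmod, Re, Im; apply Rsqr_incr_0_var.
  - rewrite Rsqr_sqrt by nra.
    unfold Rsqr; assert (A := Rabs_pos (fst z)); assert (B := Rabs_pos (snd z)).
    rewrite <- (pow2_abs (fst z)), <- (pow2_abs (snd z)). nra.
  - apply Rplus_le_le_0_compat; apply Rabs_pos.
Qed.

Lemma im_le_Cmod (z : C) : Rabs (Im z) <= Cmod z.
Proof. eapply Rle_trans; [apply Rmax_r|apply Rmax_Cmod]. Qed.

(** Comes down to the derivatives at 0 of exp, cos and sin, since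
    exp x cos y - 1 - x = exp x (cos y - 1) + (exp x - 1 - x) and
    exp x sin y - y = exp x (sin y - y) + (exp x - 1) y. *)
Lemma Cexp_negligible : negligible (fun k => Cexp k - 1 - k)%C.
Proof.
  intros eps He.
  set (e := Rmin (eps / 8) 1).
  assert (He' : 0 < e) by (apply Rmin_pos; lra).
  assert (e8 : e <= eps / 8) by apply Rmin_l.
  assert (e1 : e <= 1) by apply Rmin_r.
  destruct (real_deriv_bound exp 1 e) as [d1 [Hd1 H1]]; auto.
  { auto_derive; auto. rewrite exp_0; ring. }
  destruct (real_deriv_bound cos 0 e) as [d2 [Hd2 H2]]; auto.
  { auto_derive; auto. rewrite sin_0; ring. }
  destruct (real_deriv_bound sin 1 e) as [d3 [Hd3 H3]]; auto.
  { auto_derive; auto. rewrite cos_0; ring. }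
  set (d := Rmin (Rmin d1 (Rmin d2 d3)) (e / 2)).
  exists d; split; [repeat apply Rmin_pos; lra|].
  intros [x y] Hk.
  assert (D1 : d <= Rmin d1 (Rmin d2 d3)) by apply Rmin_l.
  assert (D2 : d <= e / 2) by apply Rmin_r.
  assert (D3 := Rmin_l d1 (Rmin d2 d3)); assert (D4 := Rmin_r d1 (Rmin d2 d3)).
  assert (D5 := Rmin_l d2 d3); assert (D6 := Rmin_r d2 d3).
  assert (Hx := re_le_Cmod (x, y)); assert (Hy := im_le_Cmod (x, y)); simpl in Hx, Hy.
  set (m := Cmod (x, y)) in *.
  specialize (H1 x ltac:(lra)); specialize (H2 y ltac:(lra)); specialize (H3 y ltac:(lra)).
  rewrite exp_0 in H1; rewrite cos_0 in H2; rewrite sin_0 in H3.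
  eapply Rle_trans; [apply Cmod_le_abs|]; unfold Cexp; simpl.
  assert (X0 := Rabs_pos x); assert (Y0 := Rabs_pos y).
  assert (E1 : Rabs (exp x - 1) <= 2 * Rabs x).
  { replace (exp x - 1) with ((exp x - 1 - 1 * x) + x) by ring.
    eapply Rle_trans; [apply Rabs_triang|]; nra. }
  assert (E2 : exp x <= 2).
  { assert (T := Rle_abs (exp x - 1)); lra. }
  assert (E3 := exp_pos x).
  assert (C1 : Rabs (exp x * (cos y - 1 - 0 * y)) <= 2 * (e * Rabs y)).
  { rewrite Rabs_mult, (Rabs_pos_eq (exp x)) by lra.
    apply Rmult_le_compat; try lra; apply Rabs_pos. }
  assert (C2 : Rabs (exp x * (sin y - 0 - 1 * y)) <= 2 * (e * Rabs y)).
  { rewrite Rabs_mult, (Rabs_pos_eq (exp x)) by lra.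
    apply Rmult_le_compat; try lra; apply Rabs_pos. }
  assert (C3 : Rabs ((exp x - 1) * y) <= e * Rabs y).
  { rewrite Rabs_mult; apply Rmult_le_compat_r; lra. }
  assert (T1 : Rabs (exp x * cos y + - (1) + - x) <= 2 * (e * Rabs y) + e * Rabs x).
  { replace (exp x * cos y + - (1) + - x)
      with (exp x * (cos y - 1 - 0 * y) + (exp x - 1 - 1 * x)) by ring.
    eapply Rle_trans; [apply Rabs_triang|lra]. }
  assert (T2 : Rabs (exp x * sin y + - 0 + - y) <= 3 * (e * Rabs y)).
  { replace (exp x * sin y + - 0 + - y)
      with (exp x * (sin y - 0 - 1 * y) + (exp x - 1) * y) by ring.
    eapply Rle_trans; [apply Rabs_triang|lra]. }
  assert (m0 : 0 <= m) by lra.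
  assert (e * Rabs y <= e * m) by (apply Rmult_le_compat_l; lra).
  assert (e * Rabs x <= e * m) by (apply Rmult_le_compat_l; lra).
  assert (e * m <= eps / 8 * m) by (apply Rmult_le_compat_r; lra).
  assert (0 <= eps * m) by (apply Rmult_le_pos; lra).
  lra.
Qed.

(** With m the increment of [f],
    exp (f + m) - exp f - exp f L = exp f ((exp m - 1 - m) + (m - L)), where L
    is the differential of [f]. *)
Lemma is_wirt_Cexp (f : C -> C) (z P Q : C) :
  is_wirt f z P Q ->
  is_wirt (fun w => Cexp (f w)) z (Cexp (f z) * P) (Cexp (f z) * Q).
Proof.
  intros H.
  eapply negligible_ext;
    [|apply (negligible_scal (Cexp (f z)) _
         (negligible_plus _ _
            (negligible_comp _ _ Cexp_negligible (is_wirt_lipschitz _ _ _ _ H)) H))].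
  intros k; cbv beta.
  replace (Cexp (f (z + k)%C)) with (Cexp (f z + (f (z + k) - f z)))%C by (f_equal; ring).
  rewrite Cexp_plus; ring.
Qed.

(** * Wirtinger expansions and derivatives *)

Lemma Cconj_RtoC (t : R) : Cconj t = t.
Proof. unfold Cconj, RtoC; simpl; f_equal; ring. Qed.

(** What real and imaginary part have in common; arguments about real
    derivatives are made once for both. *)
Definition coordinate (phi : C -> R) : Prop :=
  (forall w, Rabs (phi w) <= Cmod w) /\
  (forall v w, phi (v - w)%C = phi v - phi w) /\
  (forall (t : R) w, phi (t * w)%C = t * phi w).

Lemma Re_coordinate : coordinate Re.
Proof. repeat split; intros; [apply re_le_Cmod|unfold Re; simpl; ring..]. Qed.

Lemma Im_coordinate : coordinate Im.
Proof. repeat split; intros; [apply im_le_Cmod|unfold Im; simpl; ring..]. Qed.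

(** Along a unit direction [u] the remainder o(|t u|) is o(t), and the
    differential evaluates to t (P u + Q conj u). *)
Lemma is_wirt_slice (f : C -> C) (z P Q : C) (u : C) (phi : C -> R) :
  is_wirt f z P Q -> Cmod u = 1 -> coordinate phi ->
  is_derive (fun t : R => phi (f (z + t * u)%C)) 0 (phi (P * u + Q * Cconj u)%C).
Proof.
  intros H Hu [Hb [Hm Hs]]; apply is_derive_Reals; intros eps He.
  destruct (H (eps / 2)) as [d [Hd Hk]]; [lra|].
  exists (mkposreal d Hd); intros t Ht Htd; simpl in Htd.
  specialize (Hk (t * u)%C).
  rewrite Cmod_mult, Cmod_R, Hu, Rmult_1_r in Hk; specialize (Hk Htd).
  rewrite Rplus_0_l.
  replace (phi (f (z + t * u)%C) - phi (f (z + 0 * u)%C)) with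
    (phi (f (z + t * u) - f z - (P * (t * u) + Q * Cconj (t * u)))%C
       + t * phi (P * u + Q * Cconj u)%C).
  2:{ rewrite <- Hs, Hm, Hm.
      replace (z + 0 * u)%C with z by ring.
      rewrite Cmult_conj.
      rewrite Cconj_RtoC.
      replace (P * (t * u) + Q * (t * Cconj u))%C with (t * (P * u + Q * Cconj u))%C by ring.
      ring. }
  set (r := phi (f (z + t * u) - f z - (P * (t * u) + Q * Cconj (t * u)))%C).
  assert (Hr : Rabs r <= eps / 2 * Rabs t) by (eapply Rle_trans; [apply Hb|apply Hk]).
  replace ((r + t * phi (P * u + Q * Cconj u)%C) / t - phi (P * u + Q * Cconj u)%C)
    with (r / t) by (field; auto).
  unfold Rdiv; rewrite Rabs_mult, Rabs_inv.
  assert (T := Rabs_pos_lt t Ht).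
  apply Rmult_lt_reg_r with (Rabs t); auto.
  rewrite Rmult_assoc, Rinv_l by lra; nra.
Qed.

Lemma Derive_shift (g h : R -> R) (x l : R) :
  (forall t, g (x + t) = h t) -> is_derive h 0 l -> Derive g x = l.
Proof.
  intros E H; apply is_derive_unique.
  apply is_derive_ext with (fun s => h (s - x)).
  { intros s; rewrite <- E; f_equal; ring. }
  apply is_derive_Reals in H; apply is_derive_Reals.
  intros eps He; destruct (H eps He) as [d Hd]; exists d; intros t Ht Htd.
  specialize (Hd t Ht Htd).
  replace (x + t - x) with (0 + t) by ring; replace (x - x) with 0 by ring; auto.
Qed.

Lemma partial_x_wirt (f : C -> C) (z P Q : C) :
  is_wirt f z P Q -> partial_x f z = (P + Q)%C.
Proof.
  intros H; unfold partial_x.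
  assert (R1 := is_wirt_slice f z P Q 1 Re H Cmod_1 Re_coordinate).
  assert (I1 := is_wirt_slice f z P Q 1 Im H Cmod_1 Im_coordinate).
  assert (S : forall t, (Re z + t, Im z) = (z + t * 1)%C).
  { intros t; destruct z; unfold Cplus, Cmult, RtoC; simpl; f_equal; ring. }
  erewrite (Derive_shift _ _ _ _ _ R1), (Derive_shift _ _ _ _ _ I1).
  destruct P, Q; unfold Cplus, Cmult, RtoC; simpl; f_equal; ring.
  Unshelve. all: intros t; simpl; now rewrite S.
Qed.

Lemma partial_y_wirt (f : C -> C) (z P Q : C) :
  is_wirt f z P Q -> partial_y f z = (Ci * (P - Q))%C.
Proof.
  intros H; unfold partial_y.
  assert (R1 := is_wirt_slice f z P Q Ci Re H Cmod_Ci Re_coordinate).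
  assert (I1 := is_wirt_slice f z P Q Ci Im H Cmod_Ci Im_coordinate).
  assert (S : forall t, (Re z, Im z + t) = (z + t * Ci)%C).
  { intros t; destruct z; unfold Cplus, Cmult, RtoC; simpl; f_equal; ring. }
  erewrite (Derive_shift _ _ _ _ _ R1), (Derive_shift _ _ _ _ _ I1).
  destruct P, Q; unfold Cplus, Cmult, Cminus, Copp, Cconj, RtoC; simpl; f_equal; ring.
  Unshelve. all: intros t; simpl; now rewrite S.
Qed.

Lemma Ci2 : (Ci * Ci = -1)%C.
Proof. unfold Ci, Cmult, RtoC; simpl; f_equal; ring. Qed.

Lemma d_z_wirt (f : C -> C) (z P Q : C) : is_wirt f z P Q -> d_z f z = P.
Proof.
  intros H; unfold d_z.
  rewrite (partial_x_wirt _ _ _ _ H), (partial_y_wirt _ _ _ _ H).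
  replace (P + Q - Ci * (Ci * (P - Q)))%C with (P + Q - (Ci * Ci) * (P - Q))%C by ring.
  rewrite Ci2; field.
Qed.

Lemma d_zbar_wirt (f : C -> C) (z P Q : C) : is_wirt f z P Q -> d_zbar f z = Q.
Proof.
  intros H; unfold d_zbar.
  rewrite (partial_x_wirt _ _ _ _ H), (partial_y_wirt _ _ _ _ H).
  replace (P + Q + Ci * (Ci * (P - Q)))%C with (P + Q + (Ci * Ci) * (P - Q))%C by ring.
  rewrite Ci2; field.
Qed.

Lemma Cplus_minus_cancel (z y : C) : (z + (y - z))%C = y.
Proof. ring. Qed.

Lemma ex_derive_wirt (f : C -> C) (z P : C) :
  is_wirt f z P 0 ->
  ex_derive (K := C_AbsRing) (V := C_NormedModule) f z.
Proof.
  intros H; exists P; split; [apply is_linear_scal_l|].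
  intros x Hx; assert (E := @is_filter_lim_locally_unique C_AbsRing (AbsRing_NormedModule C_AbsRing) _ _ Hx). subst x.
  intros eps; destruct (H eps (cond_pos eps)) as [d [Hd Hk]].
  exists (mkposreal d Hd); intros y Hy.
  assert (Hy' : Cmod (y - z) < d) by exact Hy.
  specialize (Hk (y - z)%C Hy').
  rewrite Cplus_minus_cancel in Hk.
  change (Cmod (f y - f z - (y - z) * P)%C <= eps * Cmod (y - z)%C).
  eapply Rle_trans; [|apply Hk]; right; apply (f_equal Cmod), (f_equal (Cminus (f y - f z)%C)).
  enough (E : forall u v w : C, (u * v = v * u + 0 * w)%C) by apply E.
  intros; ring.
Qed.

(** The norm of the real product space is the modulus, so the expansion
    is already the Frechet derivative. *)
Lemma real_differentiable_wirt (f : C -> C) (z P Q : C) :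
  is_wirt f z P Q ->
  ex_filterdiff (K := R_AbsRing) (U := C_R_NormedModule) (V := C_R_NormedModule)
    f (locally z).
Proof.
  assert (N : forall w : C, norm (V := C_R_NormedModule) w = Cmod w).
  { intros w; unfold norm; simpl; unfold prod_norm, Cmod; f_equal.
    simpl; unfold norm; simpl; unfold abs; simpl.
    change (Rabs (fst w) ^ 2 + Rabs (snd w) ^ 2 = fst w ^ 2 + snd w ^ 2).
    now rewrite !pow2_abs. }
  intros H; exists (fun k => P * k + Q * Cconj k)%C; split.
  - split.
    + intros x y; change ((P * (x + y) + Q * Cconj (x + y))%C
        = ((P * x + Q * Cconj x) + (P * y + Q * Cconj y))%C).
      rewrite Cplus_conj; ring.
    + intros t x.
      assert (S : forall w : C, scal (V := C_R_NormedModule) t w = (t * w)%C).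
      { intros w; unfold scal; simpl; unfold prod_scal, Cmult, RtoC; simpl.
        unfold scal; simpl; unfold mult; simpl; f_equal; ring. }
      rewrite !S, Cmult_conj.
      rewrite Cconj_RtoC.
      enough (E : forall p q s v w : C, (p * (s * v) + q * (s * w) = s * (p * v + q * w))%C)
        by apply E.
      intros; ring.
    + exists (Cmod P + Cmod Q + 1); split.
      { assert (T := Cmod_ge_0 P); assert (T' := Cmod_ge_0 Q); lra. }
      intros x; rewrite !N; eapply Rle_trans; [apply Cmod_triangle|].
      rewrite !Cmod_mult, Cmod_conj; assert (T := Cmod_ge_0 x); lra.
  - intros x Hx.
    assert (E := @is_filter_lim_locally_unique R_AbsRing C_R_NormedModule _ _ Hx). subst x.
    intros eps; destruct (H eps (cond_pos eps)) as [d [Hd Hk]].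
    assert (Hd2 : 0 < d / 2) by lra.
    exists (mkposreal (d / 2) Hd2); intros y [Hy1 Hy2].
    assert (Hy : Cmod (y - z) < d).
    { eapply Rle_lt_trans; [apply Cmod_le_abs|].
      change (Rabs (fst y - fst z) < d / 2) in Hy1.
      change (Rabs (snd y - snd z) < d / 2) in Hy2.
      unfold Re, Im; simpl. unfold Rminus in *. lra. }
    specialize (Hk (y - z)%C Hy).
    rewrite Cplus_minus_cancel in Hk.
    rewrite !N; exact Hk.
Qed.

(** * Complex power series on the unit disk *)

(** The coefficient field is fixed by hand because [C] carries several
    module structures. *)
Notation is_Cseries := (is_series (K := C_AbsRing) (V := C_NormedModule)).
Notation Csum := (@sum_n C_AbelianMonoid).

(** The summation starts with the power 1, as in the exponents of h and g. *)
Definition sums_on_disk (a : nat -> C) (A : C -> C) : Prop :=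
  forall z : C, in_disk z -> is_Cseries (fun n => a (S n) * z ^ S n)%C (A z).

Lemma is_Cseries_iff (u : nat -> C) (s : C) :
  is_Cseries u s <->
  forall eps : R, 0 < eps ->
    exists N : nat, forall n : nat, (N <= n)%nat -> Cmod (Csum u n - s)%C < eps.
Proof.
  unfold is_series; rewrite (filterlim_locally_ball_norm (K := C_AbsRing) (U := C_NormedModule)).
  split.
  - intros H eps He; destruct (H (mkposreal eps He)) as [N HN]; exists N; intros n Hn.
    exact (HN n Hn).
  - intros H eps; destruct (H eps (cond_pos eps)) as [N HN]; exists N; intros n Hn.
    exact (HN n Hn).
Qed.

Lemma Csum_S (u : nat -> C) (n : nat) : Csum u (S n) = (Csum u n + u (S n))%C.
Proof. exact (@sum_Sn C_AbelianMonoid u n). Qed.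

Lemma Csum_0 (u : nat -> C) : Csum u 0 = u 0%nat.
Proof. exact (@sum_O C_AbelianMonoid u). Qed.

Lemma Rsum_S (u : nat -> R) (n : nat) : sum_n u (S n) = sum_n u n + u (S n).
Proof. exact (@sum_Sn R_AbelianMonoid u n). Qed.

Lemma Re_Csum (u : nat -> C) (n : nat) : Re (Csum u n) = sum_n (fun k => Re (u k)) n.
Proof.
  induction n as [|n IH]; [now rewrite Csum_0, sum_O|].
  rewrite Csum_S, Rsum_S, <- IH; reflexivity.
Qed.

Lemma Im_Csum (u : nat -> C) (n : nat) : Im (Csum u n) = sum_n (fun k => Im (u k)) n.
Proof.
  induction n as [|n IH]; [now rewrite Csum_0, sum_O|].
  rewrite Csum_S, Rsum_S, <- IH; reflexivity.
Qed.

Lemma is_series_R_iff (u : nat -> R) (s : R) :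
  is_series u s <->
  forall eps : R, 0 < eps ->
    exists N : nat, forall n : nat, (N <= n)%nat -> Rabs (sum_n u n - s) < eps.
Proof.
  unfold is_series; rewrite (filterlim_locally_ball_norm (K := R_AbsRing) (U := R_NormedModule)).
  split.
  - intros H eps He; destruct (H (mkposreal eps He)) as [N HN]; exists N; intros n Hn.
    exact (HN n Hn).
  - intros H eps; destruct (H eps (cond_pos eps)) as [N HN]; exists N; intros n Hn.
    exact (HN n Hn).
Qed.

Lemma is_series_Re (u : nat -> C) (s : C) :
  is_Cseries u s -> is_series (fun n => Re (u n)) (Re s).
Proof.
  rewrite is_Cseries_iff, is_series_R_iff; intros H eps He.
  destruct (H eps He) as [N HN]; exists N; intros n Hn.
  eapply Rle_lt_trans; [|apply (HN n Hn)].
  rewrite <- Re_Csum; apply (re_le_Cmod (Csum u n - s)%C).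
Qed.

Lemma is_series_Im (u : nat -> C) (s : C) :
  is_Cseries u s -> is_series (fun n => Im (u n)) (Im s).
Proof.
  rewrite is_Cseries_iff, is_series_R_iff; intros H eps He.
  destruct (H eps He) as [N HN]; exists N; intros n Hn.
  eapply Rle_lt_trans; [|apply (HN n Hn)].
  rewrite <- Im_Csum; apply (im_le_Cmod (Csum u n - s)%C).
Qed.

Lemma is_Cseries_unique (u : nat -> C) (s t : C) :
  is_Cseries u s -> is_Cseries u t -> s = t.
Proof.
  intros Hs Ht; apply injective_projections.
  - transitivity (Series (fun n => Re (u n))).
    + symmetry; exact (is_series_unique _ _ (is_series_Re _ _ Hs)).
    + exact (is_series_unique _ _ (is_series_Re _ _ Ht)).
  - transitivity (Series (fun n => Im (u n))).
    + symmetry; exact (is_series_unique _ _ (is_series_Im _ _ Hs)).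
    + exact (is_series_unique _ _ (is_series_Im _ _ Ht)).
Qed.

(** Real and imaginary part of the sum are total real series, so the sum
    function is given explicitly and no choice is involved. *)
Lemma sums_on_disk_ex (a : nat -> C) :
  (forall z, in_disk z -> exists s, is_Cseries (fun n => a (S n) * z ^ S n)%C s) ->
  exists A, sums_on_disk a A.
Proof.
  intros H.
  exists (fun z => (Series (fun n => Re (a (S n) * z ^ S n)%C),
                    Series (fun n => Im (a (S n) * z ^ S n)%C))).
  intros z Hz; destruct (H z Hz) as [s Hs].
  rewrite (is_series_unique _ _ (is_series_Re _ _ Hs)),
    (is_series_unique _ _ (is_series_Im _ _ Hs)).
  now destruct s.
Qed.

Lemma ex_Cseries_le (u : nat -> C) (v : nat -> R) :
  (forall n, Cmod (u n) <= v n) -> ex_series v -> exists s, is_Cseries u s.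
Proof.
  intros H Hv.
  apply (ex_series_le (K := C_AbsRing) (V := C_CompleteNormedModule) u v); auto.
Qed.

Lemma Cmod_Csum_le (u : nat -> C) (v : nat -> R) (n : nat) :
  (forall n, Cmod (u n) <= v n) -> Cmod (Csum u n) <= sum_n v n.
Proof.
  intros H; induction n as [|n IH]; [now rewrite Csum_0, sum_O|].
  rewrite Csum_S, Rsum_S; eapply Rle_trans; [apply Cmod_triangle|].
  specialize (H (S n)); lra.
Qed.

Lemma sum_n_le_series (v : nat -> R) (S : R) (n : nat) :
  (forall n, 0 <= v n) -> is_series v S -> sum_n v n <= S.
Proof.
  intros Hv H; apply Rnot_lt_le; intros Hlt.
  rewrite is_series_R_iff in H; destruct (H (sum_n v n - S)) as [N HN]; [lra|].
  assert (G : forall m, sum_n v n <= sum_n v (n + m)).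
  { induction m as [|m IH]; [now rewrite Nat.add_0_r; right|].
    rewrite Nat.add_succ_r, Rsum_S; specialize (Hv (Datatypes.S (n + m))); lra. }
  specialize (HN (n + N)%nat ltac:(lia)); specialize (G N).
  apply Rabs_def2 in HN; lra.
Qed.

Lemma Cmod_series_le (u : nat -> C) (v : nat -> R) (s : C) (S : R) :
  (forall n, Cmod (u n) <= v n) -> is_Cseries u s -> is_series v S -> Cmod s <= S.
Proof.
  intros H Hu Hv; apply le_epsilon; intros eps He.
  rewrite is_Cseries_iff in Hu; destruct (Hu eps He) as [N HN].
  specialize (HN N (le_n N)).
  assert (A := Cmod_Csum_le u v N H).
  assert (B : sum_n v N <= S).
  { apply sum_n_le_series; auto.
    intros n; eapply Rle_trans; [apply Cmod_ge_0|apply H]. }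
  replace s with (Csum u N + - (Csum u N - s))%C by ring.
  eapply Rle_trans; [apply Cmod_triangle|]; rewrite Cmod_opp; lra.
Qed.

Lemma is_Cseries_plus (u v : nat -> C) (s t : C) :
  is_Cseries u s -> is_Cseries v t -> is_Cseries (fun n => u n + v n)%C (s + t)%C.
Proof. exact (is_series_plus (K := C_AbsRing) (V := C_NormedModule) u v s t). Qed.

Lemma is_Cseries_scal (c : C) (u : nat -> C) (s : C) :
  is_Cseries u s -> is_Cseries (fun n => c * u n)%C (c * s)%C.
Proof. exact (is_series_scal (K := C_AbsRing) (V := C_NormedModule) c u s). Qed.

Lemma is_Cseries_ext (u v : nat -> C) (s : C) :
  (forall n, u n = v n) -> is_Cseries u s -> is_Cseries v s.
Proof. exact (is_series_ext (K := C_AbsRing) (V := C_NormedModule) u v s). Qed.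

(** The terms of a convergent series tend to 0, hence are bounded. *)
Lemma coeff_bounded (a : nat -> C) (A : C -> C) (r : R) :
  sums_on_disk a A -> 0 <= r < 1 ->
  exists M, forall n, Rabs (Cmod (a n) * r ^ n) <= M.
Proof.
  intros H Hr.
  assert (Hz : in_disk r) by (unfold in_disk; rewrite Cmod_R, Rabs_pos_eq; lra).
  assert (B : forall u : nat -> R, ex_series u -> exists M, forall n, Rabs (u n) <= M).
  { intros u Hu; apply ex_series_lim_0 in Hu; apply is_lim_seq_Reals in Hu.
    destruct (maj_by_pos u (exist _ 0 Hu)) as [M [_ HM]]; eauto. }
  destruct (B _ (ex_intro _ _ (is_series_Re _ _ (H _ Hz)))) as [M1 HM1].
  destruct (B _ (ex_intro _ _ (is_series_Im _ _ (H _ Hz)))) as [M2 HM2].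
  exists (Rmax (Cmod (a 0%nat)) (M1 + M2)); intros [|n].
  - simpl; rewrite Rmult_1_r, Rabs_pos_eq by apply Cmod_ge_0; apply Rmax_l.
  - eapply Rle_trans; [|apply Rmax_r].
    replace (Rabs (Cmod (a (S n)) * r ^ S n)) with (Cmod (a (S n) * r ^ S n)%C).
    + eapply Rle_trans; [apply Cmod_le_abs|]; specialize (HM1 n); specialize (HM2 n); lra.
    + rewrite Cmod_mult, Cmod_pow, Cmod_R, (Rabs_pos_eq r) by lra.
      rewrite Rabs_pos_eq; auto.
      apply Rmult_le_pos; [apply Cmod_ge_0|apply pow_le; lra].
Qed.

(** Absolute values of the coefficients give a real power series whose
    radius is at least 1; what is known about real power series and their
    derivatives then yields absolute convergence of the complex ones. *)
Lemma coeff_CV_radius (a : nat -> C) (A : C -> C) (r : R) :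
  sums_on_disk a A -> 0 <= r < 1 -> Rbar_lt (Rabs r) (CV_radius (fun n => Cmod (a n))).
Proof.
  intros H Hr.
  destruct (CV_radius_bounded (fun n => Cmod (a n))) as [U _].
  assert (Hm : 0 <= (1 + r) / 2 < 1) by lra.
  apply Rbar_lt_le_trans with ((1 + r) / 2).
  - rewrite Rabs_pos_eq by lra; simpl; lra.
  - apply U, (coeff_bounded a A _ H Hm).
Qed.

Lemma ex_series_abs (a : nat -> C) (A : C -> C) (r : R) :
  sums_on_disk a A -> 0 <= r < 1 -> ex_series (fun n => Cmod (a (S n)) * r ^ S n).
Proof.
  intros H Hr.
  apply (ex_series_incr_1 (fun n => Cmod (a n) * r ^ n)).
  apply ex_series_ext with (fun n => Rabs (Cmod (a n) * r ^ n)).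
  - intros n; apply Rabs_pos_eq, Rmult_le_pos; [apply Cmod_ge_0|apply pow_le; lra].
  - apply CV_disk_inside, (coeff_CV_radius a A); auto.
Qed.

Lemma ex_series_abs_derive (a : nat -> C) (A : C -> C) (r : R) :
  sums_on_disk a A -> 0 <= r < 1 ->
  ex_series (fun n => INR (S n) * Cmod (a (S n)) * r ^ n).
Proof.
  intros H Hr.
  apply ex_series_ext with (fun n => Rabs (PS_derive (fun n => Cmod (a n)) n * r ^ n)).
  - intros n; unfold PS_derive; apply Rabs_pos_eq.
    repeat apply Rmult_le_pos; auto using pos_INR, Cmod_ge_0, pow_le with real.
    apply pow_le; lra.
  - apply CV_disk_inside; rewrite CV_radius_derive; apply (coeff_CV_radius a A); auto.
Qed.

Lemma ex_series_abs_derive2 (a : nat -> C) (A : C -> C) (r : R) :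
  sums_on_disk a A -> 0 <= r < 1 ->
  ex_series (fun n => INR (S n) * (INR (S (S n)) * Cmod (a (S (S n)))) * r ^ n).
Proof.
  intros H Hr.
  apply ex_series_ext with
    (fun n => Rabs (PS_derive (PS_derive (fun n => Cmod (a n))) n * r ^ n)).
  - intros n; unfold PS_derive; apply Rabs_pos_eq.
    repeat apply Rmult_le_pos; auto using pos_INR, Cmod_ge_0 with real.
    apply pow_le; lra.
  - apply CV_disk_inside; rewrite !CV_radius_derive; apply (coeff_CV_radius a A); auto.
Qed.

(** The first-order Taylor remainder of w^(n+1) at [z]. *)
Definition pow_remainder (z k : C) (n : nat) : C :=
  ((z + k) ^ S n - z ^ S n - INR (S n) * z ^ n * k)%C.

Lemma RtoC_INR_S (n : nat) : RtoC (INR (S n)) = (INR n + 1)%C.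
Proof. rewrite S_INR; apply RtoC_plus. Qed.

Lemma pow_remainder_S (z k : C) (n : nat) :
  pow_remainder z k (S n) =
    ((z + k) * pow_remainder z k n + INR (S n) * z ^ n * (k * k))%C.
Proof. unfold pow_remainder; rewrite !Cpow_S, !RtoC_INR_S; ring. Qed.

Lemma pow_remainder_0 (z k : C) : pow_remainder z k 0 = 0.
Proof. unfold pow_remainder; simpl; ring. Qed.

Lemma Cmod_INR (n : nat) : Cmod (INR n) = INR n.
Proof. rewrite Cmod_R; apply Rabs_pos_eq, pos_INR. Qed.

(** The bound is |k|^2 times the second derivative of x^(n+2) at rho; it
    propagates through [pow_remainder_S]. *)
Lemma pow_remainder_bound (z k : C) (rho : R) (n : nat) :
  Cmod z <= rho -> Cmod (z + k) <= rho ->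
  Cmod (pow_remainder z k (S n)) <= INR (S n) * INR (S (S n)) * rho ^ n * Cmod k ^ 2.
Proof.
  intros Hz Hzk; induction n as [|n IH].
  - rewrite pow_remainder_S, pow_remainder_0.
    replace ((z + k) * 0 + INR 1 * z ^ 0 * (k * k))%C with (k * k)%C by (simpl; ring).
    rewrite Cmod_mult; simpl; assert (T := Cmod_ge_0 k); nra.
  - rewrite pow_remainder_S.
    eapply Rle_trans; [apply Cmod_triangle|].
    rewrite !Cmod_mult, Cmod_pow, Cmod_INR.
    assert (P1 : Cmod (z + k) * Cmod (pow_remainder z k (S n)) <=
       rho * (INR (S n) * INR (S (S n)) * rho ^ n * Cmod k ^ 2)).
    { apply Rmult_le_compat; auto using Cmod_ge_0. }
    assert (P2 : Cmod z ^ S n <= rho ^ S n) by (apply pow_incr; split; auto using Cmod_ge_0).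
    assert (P3 : INR (S (S n)) * Cmod z ^ S n * (Cmod k * Cmod k) <=
       INR (S (S n)) * rho ^ S n * (Cmod k * Cmod k)).
    { apply Rmult_le_compat_r; [apply Rmult_le_pos; apply Cmod_ge_0|].
      apply Rmult_le_compat_l; auto using pos_INR. }
    assert (P4 : 0 <= INR (S (S n)) * rho ^ S n * Cmod k ^ 2).
    { apply Rmult_le_pos; [apply Rmult_le_pos|]; auto using pos_INR.
      - apply pow_le; eapply Rle_trans; [apply Cmod_ge_0|apply Hz].
      - apply pow_le, Cmod_ge_0. }
    eapply Rle_trans; [apply Rplus_le_compat; [apply P1|apply P3]|].
    rewrite (S_INR (S (S n))), (S_INR n) in *. simpl pow in *.
    set (X := INR (S (S n))) in *.
    assert (EX : X = INR n + 2) by (unfold X; rewrite !S_INR; ring).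
    nra.
Qed.

(** Termwise differentiation: the remainders of the single powers add up to
    at most |k|^2 times the absolutely convergent series of second
    derivatives. *)
Lemma power_series_wirt (a : nat -> C) (A : C -> C) (z : C) :
  sums_on_disk a A -> in_disk z ->
  exists d, is_Cseries (fun n => INR (S n) * a (S n) * z ^ n)%C d /\ is_wirt A z d 0.
Proof.
  intros H Hz; unfold in_disk in Hz; assert (Z0 := Cmod_ge_0 z).
  destruct (ex_Cseries_le (fun n => INR (S n) * a (S n) * z ^ n)%C
     (fun n => INR (S n) * Cmod (a (S n)) * Cmod z ^ n)) as [d Hd].
  { intros n; rewrite !Cmod_mult, Cmod_pow, Cmod_INR; right; auto. }
  { apply (ex_series_abs_derive a A); auto. }
  exists d; split; auto.
  (* Any rho strictly between |z| and 1 would do: z + k stays in the closed disk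
     of radius rho while |k| < rho - |z|. *)
  set (rho := (1 + Cmod z) / 2).
  assert (Hrho : 0 <= rho < 1) by (unfold rho; lra).
  assert (E2 := ex_series_abs_derive2 a A rho H Hrho).
  set (v := fun n => Cmod (a (S n)) * (INR n * INR (S n) * rho ^ pred n)).
  assert (Hv : ex_series v).
  { apply (ex_series_incr_1 v).
    eapply ex_series_ext; [|apply E2]; intros n; unfold v; simpl pred.
    change (scal (INR (S n)) (scal (INR (S (S n))) (Cmod (a (S (S n)))))) with
      (INR (S n) * (INR (S (S n)) * Cmod (a (S (S n))))).
    simpl; ring. }
  destruct Hv as [K HK].
  apply negligible_quadratic with K (rho - Cmod z); [unfold rho; lra|].
  intros k Hk.
  assert (Hzk : Cmod (z + k) <= rho) by (eapply Rle_trans; [apply Cmod_triangle|lra]).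
  assert (Dzk : in_disk (z + k)) by (unfold in_disk; lra).
  apply Cmod_series_le with (fun n => a (S n) * pow_remainder z k n)%C
      (fun n => Cmod k ^ 2 * v n).
  - intros n; unfold v; rewrite Cmod_mult.
    replace (Cmod k ^ 2 * (Cmod (a (S n)) * (INR n * INR (S n) * rho ^ pred n)))
      with (Cmod (a (S n)) * (INR n * INR (S n) * rho ^ pred n * Cmod k ^ 2)) by ring.
    apply Rmult_le_compat_l; [apply Cmod_ge_0|].
    destruct n as [|n].
    + rewrite pow_remainder_0, Cmod_0; simpl; lra.
    + apply pow_remainder_bound; auto. unfold rho; lra.
  - assert (S1 := H _ Dzk); assert (S2 := H z Hz).
    assert (S3 := is_Cseries_plus _ _ _ _ S1
       (is_Cseries_plus _ _ _ _ (is_Cseries_scal (-1) _ _ S2)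
          (is_Cseries_scal (- k) _ _ Hd))).
    replace (A (z + k) - A z - (d * k + 0 * Cconj k))%C with
      (A (z + k) + ((-1) * A z + - k * d))%C by ring.
    eapply is_Cseries_ext; [|apply S3].
    intros n; unfold pow_remainder; simpl; ring.
  - apply (is_series_scal_r (Cmod k ^ 2)) in HK.
    eapply is_series_ext; [|apply HK]; intros n; simpl; apply Rmult_comm.
Qed.

(** * Coefficients of functions with real part bounded below *)

Lemma sin_2PI_mult (k : Z) : sin (IZR k * (2 * PI)) = 0.
Proof. apply sin_eq_0_1; exists (2 * k)%Z; rewrite mult_IZR; ring. Qed.

Lemma cos_2PI_mult (k : Z) : cos (IZR k * (2 * PI)) = 1.
Proof.
  replace (IZR k * (2 * PI)) with (2 * (IZR k * PI)) by ring.
  rewrite cos_2a_sin, (sin_eq_0_1 (IZR k * PI)); [ring|eauto].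
Qed.

(** Integration over a period, phrased through a primitive: only the
    constant mode contributes. *)
Lemma trig_antiderivative (k : Z) (p q : R) :
  exists W : R -> R,
    (forall t, is_derive W t (p * cos (IZR k * t) + q * sin (IZR k * t))) /\
    W (2 * PI) - W 0 = if Z.eq_dec k 0 then 2 * PI * p else 0.
Proof.
  destruct (Z.eq_dec k 0) as [->|Hk].
  - exists (fun t => p * t); split; [intros t|ring].
    auto_derive; auto. rewrite Rmult_0_l, cos_0, sin_0; ring.
  - assert (Hk' : IZR k <> 0) by now apply not_0_IZR.
    exists (fun t => (p * sin (IZR k * t) - q * cos (IZR k * t)) / IZR k); split.
    + intros t; auto_derive; auto. field; auto.
    + rewrite sin_2PI_mult, cos_2PI_mult, !Rmult_0_r, sin_0, cos_0; field; auto.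
Qed.

(** With c = x + i y the first factor is Re (c e^(imt)). The product splits
    into the modes m, m - n and m + n, of which only m - n can be constant. *)
Lemma mode_antiderivative (m n : nat) (x y u v : R) :
  (1 <= m)%nat -> (1 <= n)%nat ->
  exists W : R -> R,
    (forall t, is_derive W t
       ((x * cos (INR m * t) - y * sin (INR m * t)) *
        (1 + u * cos (INR n * t) + v * sin (INR n * t)))) /\
    W (2 * PI) - W 0 = if Nat.eq_dec m n then PI * (x * u - y * v) else 0.
Proof.
  intros Hm Hn.
  destruct (trig_antiderivative (Z.of_nat m) x (- y)) as [W1 [D1 E1]].
  destruct (trig_antiderivative (Z.of_nat m - Z.of_nat n)
    ((x * u - y * v) / 2) ((- x * v - y * u) / 2)) as [W2 [D2 E2]].
  destruct (trig_antiderivative (Z.of_nat m + Z.of_nat n)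
    ((x * u + y * v) / 2) ((x * v - y * u) / 2)) as [W3 [D3 E3]].
  exists (fun t => W1 t + (W2 t + W3 t)); split.
  - intros t.
    assert (D := is_derive_plus _ _ _ _ _ (D1 t) (is_derive_plus _ _ _ _ _ (D2 t) (D3 t))).
    eapply is_derive_ext; [|eapply eq_ind; [apply D|]]; [intros; reflexivity|].
    unfold plus; simpl.
    rewrite minus_IZR, plus_IZR, <- !INR_IZR_INZ.
    replace ((INR m - INR n) * t) with (INR m * t - INR n * t) by ring.
    replace ((INR m + INR n) * t) with (INR m * t + INR n * t) by ring.
    rewrite cos_plus, cos_minus, sin_plus, sin_minus; field.
  - destruct (Z.eq_dec (Z.of_nat m) 0); [lia|].
    destruct (Z.eq_dec (Z.of_nat m + Z.of_nat n) 0); [lia|].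
    destruct (Nat.eq_dec m n), (Z.eq_dec (Z.of_nat m - Z.of_nat n) 0); try lia; lra.
Qed.

Definition polar (r t : R) : C := (r * cos t, r * sin t).

Lemma polar_pow (r t : R) (m : nat) : (polar r t ^ m)%C = polar (r ^ m) (INR m * t).
Proof.
  unfold polar.
  induction m as [|m IH].
  - simpl; rewrite Rmult_0_l, cos_0, sin_0; unfold RtoC; f_equal; ring.
  - rewrite Cpow_S, IH, S_INR.
    replace ((INR m + 1) * t) with (INR m * t + t) by ring.
    rewrite cos_plus, sin_plus; unfold Cmult; simpl; f_equal; ring.
Qed.

Lemma Cmod_polar (r t : R) : 0 <= r -> Cmod (polar r t) = r.
Proof.
  intros Hr; unfold polar, Cmod; simpl fst; simpl snd.
  replace (_ + _) with (r²); [now apply sqrt_Rsqr|].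
  assert (T := sin2_cos2 t); unfold Rsqr in *; nra.
Qed.

(** On the circle of radius [r] the kernel picks out the n-th coefficient
    of a partial sum, as soon as the partial sum contains it. *)
Lemma partial_sum_antiderivative (c : nat -> C) (r u v : R) (n M : nat) :
  (1 <= n)%nat ->
  exists W : R -> R,
    (forall t, is_derive W t
       (Re (Csum (fun m => c (S m) * polar r t ^ S m)%C M) *
        (1 + u * cos (INR n * t) + v * sin (INR n * t)))) /\
    W (2 * PI) - W 0 =
      if Compare_dec.le_dec n (S M) then PI * (r ^ n * (Re (c n) * u - Im (c n) * v)) else 0.
Proof.
  intros Hn.
  assert (T : forall m t, Re (c (S m) * polar r t ^ S m)%C =
     (r ^ S m * Re (c (S m))) * cos (INR (S m) * t) -
     (r ^ S m * Im (c (S m))) * sin (INR (S m) * t)).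
  { intros m t; rewrite polar_pow; unfold polar; destruct (c (S m)); unfold Re, Im, Cmult.
    cbn [fst snd]; ring. }
  induction M as [|M [W [D E]]].
  - destruct (mode_antiderivative 1 n (r ^ 1 * Re (c 1%nat)) (r ^ 1 * Im (c 1%nat)) u v
       (le_n 1) Hn) as [W [D E]].
    exists W; split.
    + intros t; rewrite Csum_0, T; apply D.
    + rewrite E; destruct (Nat.eq_dec 1 n) as [<-|N].
      * destruct (Compare_dec.le_dec 1 1); [ring|lia].
      * destruct (Compare_dec.le_dec n 1); [lia|reflexivity].
  - destruct (mode_antiderivative (S (S M)) n (r ^ S (S M) * Re (c (S (S M))))
       (r ^ S (S M) * Im (c (S (S M)))) u v ltac:(lia) Hn) as [W' [D' E']].
    exists (fun t => W t + W' t); split.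
    + intros t; assert (P := is_derive_plus _ _ _ _ _ (D t) (D' t)).
      rewrite Csum_S.
      eapply is_derive_ext; [|eapply eq_ind; [apply P|]]; [intros; reflexivity|].
      rewrite <- T; unfold plus.
      set (X := Csum _ M); set (Y := (c (S (S M)) * _)%C).
      change (Re (X + Y)%C) with (Re X + Re Y). simpl; ring.
    + destruct (Nat.eq_dec (S (S M)) n) as [<-|N].
      * destruct (Compare_dec.le_dec (S (S M)) (S M)); [lia|].
        destruct (Compare_dec.le_dec (S (S M)) (S (S M))); [lra|lia].
      * destruct (Compare_dec.le_dec n (S M)), (Compare_dec.le_dec n (S (S M))); try lia; lra.
Qed.

Lemma increasing_of_deriv (W w : R -> R) (a b : R) :
  a < b -> (forall t, is_derive W t (w t)) -> (forall t, 0 <= w t) -> W a <= W b.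
Proof.
  intros Hab D P.
  destruct (MVT_gen W a b w) as [t [_ E]].
  - intros; apply D.
  - intros; apply derivable_continuous_pt; exists (w x); apply is_derive_Reals, D.
  - specialize (P t); nra.
Qed.

(** On a circle inside the disk the tail bound does not depend on the
    point, which makes the approximation by partial sums uniform. *)
Lemma series_tail (u : nat -> C) (v : nat -> R) (s : C) (S : R) (M : nat) :
  (forall n, Cmod (u n) <= v n) -> is_Cseries u s -> is_series v S ->
  Cmod (Csum u M - s) <= S - sum_n v M.
Proof.
  intros H Hu Hv; apply le_epsilon; intros eps He.
  rewrite is_Cseries_iff in Hu; destruct (Hu eps He) as [N HN].
  specialize (HN (M + N)%nat ltac:(lia)).
  assert (V0 : forall n, 0 <= v n).
  { intros n; eapply Rle_trans; [apply Cmod_ge_0|apply H]. }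
  assert (B := sum_n_le_series v S (M + N) V0 Hv).
  assert (A : Cmod (Csum u M - Csum u (M + N)) <= sum_n v (M + N) - sum_n v M).
  { generalize N; intros k; induction k as [|k IH].
    - rewrite Nat.add_0_r; replace (Csum u M - Csum u M)%C with (RtoC 0) by ring.
      rewrite Cmod_0; lra.
    - rewrite Nat.add_succ_r, Csum_S, Rsum_S.
      replace (Csum u M - (Csum u (M + k) + u (Datatypes.S (M + k))))%C with
        ((Csum u M - Csum u (M + k)) + - u (Datatypes.S (M + k)))%C by ring.
      eapply Rle_trans; [apply Cmod_triangle|]; rewrite Cmod_opp.
      specialize (H (Datatypes.S (M + k))); lra. }
  replace (Csum u M - s)%C with
    ((Csum u M - Csum u (M + N)) + (Csum u (M + N) - s))%C by ring.
  eapply Rle_trans; [apply Cmod_triangle|]; lra.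
Qed.

(** Twice the kernel is (u + cos t)^2 + (v + sin t)^2. *)
Lemma kernel_nonneg (u v t : R) : u ^ 2 + v ^ 2 = 1 -> 0 <= 1 + u * cos t + v * sin t.
Proof.
  intros H; assert (T := sin2_cos2 t); unfold Rsqr in T.
  
  assert (A := pow2_ge_0 (u + cos t)); assert (B := pow2_ge_0 (v + sin t)); nra.
Qed.

(** A partial sum with Re > - (beta + eps/2) on the circle is integrated
    against the kernel 1 + u cos nt + v sin nt >= 0. The constant part gives
    2 PI (beta + eps/2) and the n-th mode gives - PI |c_n| r^n, for a suitable
    unit vector (u, v). *)
Lemma coefficient_bound_radius (c : nat -> C) (q : C -> C) (beta r : R) (n : nat) :
  sums_on_disk c q ->
  (forall z, in_disk z -> z <> RtoC 0 -> - beta < Re (q z)) ->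
  (1 <= n)%nat -> 0 < r < 1 -> Cmod (c n) * r ^ n <= 2 * beta.
Proof.
  intros Hq Hp Hn Hr.
  apply le_epsilon; intros eps He.
  destruct (ex_series_abs c q r Hq ltac:(lra)) as [S HS].
  assert (HS' := HS); rewrite is_series_R_iff in HS'.
  destruct (HS' (eps / 2) ltac:(lra)) as [N HN].
  set (M := (N + n)%nat); specialize (HN M ltac:(lia)).
  (* A unit vector with u + i v = - conj (c_n) / |c_n|, arbitrary when c_n = 0. *)
  assert (Huv : exists u v, u ^ 2 + v ^ 2 = 1 /\
     Re (c n) * u - Im (c n) * v = - Cmod (c n)).
  { destruct (Req_dec (Cmod (c n)) 0) as [E|E].
    - exists 1, 0; split; [ring|]; rewrite E; apply Cmod_eq_0 in E; rewrite E; simpl; ring.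
    - assert (Q := Cmod2_alt (c n)).
      exists (- Re (c n) / Cmod (c n)), (Im (c n) / Cmod (c n)); split.
      + transitivity ((Re (c n) ^ 2 + Im (c n) ^ 2) / Cmod (c n) ^ 2); [field; auto|].
        rewrite <- Q; field; auto.
      + transitivity (- (Re (c n) ^ 2 + Im (c n) ^ 2) / Cmod (c n)); [field; auto|].
        rewrite <- Q; field; auto. }
  destruct Huv as [u [v [Huv Ev]]].
  destruct (partial_sum_antiderivative c r u v n M Hn) as [W [D E]].
  destruct (trig_antiderivative (Z.of_nat n) u v) as [W0 [D0 E0]].
  destruct (Z.eq_dec (Z.of_nat n) 0); [lia|].
  destruct (Compare_dec.le_dec n (Datatypes.S M)); [|lia].
  set (b := beta + eps / 2).
  assert (G : W 0 + b * (0 + W0 0) <= W (2 * PI) + b * (2 * PI + W0 (2 * PI))).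
  { apply (increasing_of_deriv (fun t => W t + b * (t + W0 t))
      (fun t => (Re (Csum (fun m => c (Datatypes.S m) *
           polar r t ^ Datatypes.S m)%C M) + b) *
        (1 + u * cos (INR n * t) + v * sin (INR n * t)))).
    - assert (P := PI_RGT_0); lra.
    - intros t; specialize (D t); specialize (D0 t).
      assert (P := is_derive_plus _ _ _ _ _ D
         (is_derive_scal (fun t => t + W0 t) t b _
            (is_derive_plus _ _ _ _ _ (is_derive_id t) D0))).
      eapply is_derive_ext; [|eapply eq_ind; [apply P|]]; [intros; reflexivity|].
      unfold plus, one; simpl; rewrite <- INR_IZR_INZ; ring.
    - intros t; apply Rmult_le_pos; [|now apply kernel_nonneg].
      set (z := polar r t).
      assert (Ez : Cmod z = r) by (apply Cmod_polar; lra).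
      assert (Dz : in_disk z) by (unfold in_disk; lra).
      assert (Z0 : z <> RtoC 0) by (intros X; rewrite X, Cmod_0 in Ez; lra).
      specialize (Hp z Dz Z0).
      assert (T := fun H => series_tail _ _ _ S M H (Hq z Dz) HS).
      specialize (T ltac:(intros m; cbv beta; rewrite Cmod_mult, Cmod_pow, Ez; apply Rle_refl)).
      apply Rabs_def2 in HN.
      set (X := Csum (fun m => c (Datatypes.S m) * z ^ Datatypes.S m)%C M) in *.
      assert (T2 : Rabs (Re X - Re (q z)) < eps / 2).
      { eapply Rle_lt_trans; [apply (re_le_Cmod (X - q z)%C)|lra]. }
      apply Rabs_def2 in T2; unfold b; lra. }
  rewrite Ev in E.
  assert (P := PI_RGT_0); unfold b in G.
  assert (PI * (Cmod (c n) * r ^ n) <= PI * (2 * beta + eps)) by nra.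
  apply Rmult_le_reg_l with PI; auto.
Qed.

Lemma pow_lower_bound (d : R) (n : nat) : 0 <= d <= 1 -> 1 - INR n * d <= (1 - d) ^ n.
Proof.
  intros Hd; induction n as [|n IH]; [simpl; lra|].
  rewrite S_INR; simpl pow; assert (T := pos_INR n); assert (0 <= (1 - d) ^ n) by (apply pow_le; lra).
  apply Rle_trans with ((1 - d) * (1 - INR n * d)); [nra|].
  apply Rmult_le_compat_l; lra.
Qed.

(** Caratheodory's inequality, obtained by letting the radius tend to 1;
    [pow_lower_bound] makes this limit quantitative. *)
Lemma coefficient_bound (c : nat -> C) (q : C -> C) (beta : R) (n : nat) :
  sums_on_disk c q ->
  (forall z, in_disk z -> z <> RtoC 0 -> - beta < Re (q z)) ->
  (1 <= n)%nat -> Cmod (c n) <= 2 * beta.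
Proof.
  intros Hq Hp Hn; apply le_epsilon; intros eps He.
  assert (C0 := Cmod_ge_0 (c n)); assert (N0 := pos_INR n).
  assert (X0 : 0 <= Cmod (c n) * INR n) by now apply Rmult_le_pos.
  set (d := Rmin (eps / (Cmod (c n) * INR n + 1)) (1 / 2)).
  assert (Hd : 0 < d).
  { apply Rmin_pos; [apply Rdiv_lt_0_compat|]; lra. }
  assert (d1 : d <= 1 / 2) by apply Rmin_r.
  assert (d2 : d <= eps / (Cmod (c n) * INR n + 1)) by apply Rmin_l.
  assert (B := coefficient_bound_radius c q beta (1 - d) n Hq Hp Hn ltac:(lra)).
  assert (L := pow_lower_bound d n ltac:(lra)).
  assert (Cmod (c n) * (1 - INR n * d) <= Cmod (c n) * (1 - d) ^ n)
    by (apply Rmult_le_compat_l; auto).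
  assert ((Cmod (c n) * INR n + 1) * d <= eps).
  { apply Rle_trans with ((Cmod (c n) * INR n + 1) * (eps / (Cmod (c n) * INR n + 1))).
    - apply Rmult_le_compat_l; lra.
    - right; field; lra. }
  nra.
Qed.

(** * The angular derivative of a log-harmonic product *)

Lemma product_wirt (f A B : C -> C) (z A' B' : C) :
  in_disk z ->
  (forall w, in_disk w -> f w = (w * Cexp (A w) * Cconj (Cexp (B w)))%C) ->
  is_wirt A z A' 0 -> is_wirt B z B' 0 ->
  is_wirt f z (Cexp (A z) * Cconj (Cexp (B z)) * (1 + z * A'))
    (z * Cexp (A z) * Cconj (Cexp (B z)) * Cconj B').
Proof.
  intros Hz Hf HA HB.
  assert (W := is_wirt_mult _ _ _ _ _ _ _
     (is_wirt_mult _ _ _ _ _ _ _ (is_wirt_id z) (is_wirt_Cexp _ _ _ _ HA))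
     (is_wirt_conj _ _ _ _ (is_wirt_Cexp _ _ _ _ HB))).
  eapply is_wirt_ext_disk; [exact Hz|intros w Hw; symmetry; apply Hf, Hw|].
  eapply is_wirt_eq; [exact W| |]; rewrite !Cmult_conj;
    rewrite ?Cconj_RtoC;
    ring.
Qed.

Lemma Cconj_neq_0 (w : C) : w <> RtoC 0 -> Cconj w <> RtoC 0.
Proof.
  intros H E; apply H, Cmod_eq_0; rewrite <- Cmod_conj, E; apply Cmod_0.
Qed.

(** The conjugate on z B' disappears in the real part, which is why only
    the holomorphic function z A' - z B' remains. *)
Lemma angular_quotient (f A B : C -> C) (z A' B' : C) :
  in_disk z -> z <> RtoC 0 ->
  (forall w, in_disk w -> f w = (w * Cexp (A w) * Cconj (Cexp (B w)))%C) ->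
  is_wirt A z A' 0 -> is_wirt B z B' 0 ->
  Re ((z * d_z f z - Cconj z * d_zbar f z) / f z)%C = 1 + Re (z * A' - z * B')%C.
Proof.
  intros Hz Z0 Hf HA HB.
  assert (W := product_wirt f A B z A' B' Hz Hf HA HB).
  rewrite (d_z_wirt _ _ _ _ W), (d_zbar_wirt _ _ _ _ W), (Hf z Hz).
  set (E := Cexp (A z)); set (G := Cconj (Cexp (B z))).
  assert (E0 : E <> RtoC 0) by apply Cexp_neq_0.
  assert (G0 : G <> RtoC 0) by apply Cconj_neq_0, Cexp_neq_0.
  replace ((z * (E * G * (1 + z * A')) - Cconj z * (z * E * G * Cconj B')) / (z * E * G))%C
    with (1 + z * A' - Cconj (z * B'))%C by (rewrite Cmult_conj; field; auto).
  unfold Re, Cconj; simpl; ring.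
Qed.

Lemma derivative_series (a : nat -> C) (A : C -> C) (z : C) :
  sums_on_disk a A -> in_disk z ->
  exists A', is_wirt A z A' 0 /\
    is_Cseries (fun n => INR (S n) * a (S n) * z ^ S n)%C (z * A')%C.
Proof.
  intros H Hz; destruct (power_series_wirt a A z H Hz) as [A' [S D]].
  exists A'; split; auto.
  eapply is_Cseries_ext; [|apply (is_Cseries_scal z _ _ S)].
  intros n; simpl; ring.
Qed.

Lemma exp_power_series_sums (h : C -> C) (a : nat -> C) :
  exp_power_series h a ->
  exists A, sums_on_disk a A /\ forall z, in_disk z -> h z = Cexp (A z).
Proof.
  intros H; destruct (sums_on_disk_ex a) as [A HA].
  - intros z Hz; destruct (H z Hz) as [s [Hs _]]; eauto.
  - exists A; split; auto; intros z Hz.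
    destruct (H z Hz) as [s [Hs ->]].
    now rewrite (is_Cseries_unique _ _ _ Hs (HA z Hz)).
Qed.

(** The point of this form: the left-hand side involves [f] only, the
    right-hand side only the coefficients. *)
Lemma angular_quotient_series (f h g : C -> C) (a b : nat -> C) :
  log_harmonic_rep f h g a b ->
  exists q, sums_on_disk (fun n => INR n * (a n - b n))%C q /\
    forall z, in_disk z -> z <> RtoC 0 ->
      Re ((z * d_z f z - Cconj z * d_zbar f z) / f z)%C = 1 + Re (q z).
Proof.
  intros [_ [_ [_ [_ [Ha [Hb Hf]]]]]].
  destruct (exp_power_series_sums h a Ha) as [A [SA EA]].
  destruct (exp_power_series_sums g b Hb) as [B [SB EB]].
  assert (Hf' : forall w, in_disk w -> f w = (w * Cexp (A w) * Cconj (Cexp (B w)))%C).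
  { intros w Hw; rewrite <- EA, <- EB by auto; apply Hf, Hw. }
  assert (S : forall z, in_disk z -> exists A' B',
     is_wirt A z A' 0 /\ is_wirt B z B' 0 /\
     is_Cseries (fun n => INR (S n) * (a (S n) - b (S n)) * z ^ S n)%C
       (z * A' - z * B')%C).
  { intros z Hz.
    destruct (derivative_series a A z SA Hz) as [A' [WA DA]].
    destruct (derivative_series b B z SB Hz) as [B' [WB DB]].
    exists A', B'; repeat split; auto.
    replace (z * A' - z * B')%C with (z * A' + (-1) * (z * B'))%C by ring.
    eapply is_Cseries_ext;
      [|apply (is_Cseries_plus _ _ _ _ DA (is_Cseries_scal (-1) _ _ DB))].
    intros n; simpl; ring. }
  destruct (sums_on_disk_ex (fun n => INR n * (a n - b n))%C) as [q Hq].
  { intros z Hz; destruct (S z Hz) as [A' [B' [_ [_ H]]]]; eauto. }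
  exists q; split; auto; intros z Hz Z0.
  destruct (S z Hz) as [A' [B' [WA [WB H]]]].
  rewrite (is_Cseries_unique _ _ _ (Hq z Hz) H).
  now apply (angular_quotient f A B).
Qed.

Lemma starlike_coefficient_bound (alpha : R) (f h g : C -> C) (a b : nat -> C) (n : nat) :
  S_Lh_star alpha f -> log_harmonic_rep f h g a b -> (1 <= n)%nat ->
  Cmod (a n - b n)%C <= 2 * (1 - alpha) / INR n.
Proof.
  intros [_ Hs] Hrep Hn.
  destruct (angular_quotient_series f h g a b Hrep) as [q [Hq E]].
  assert (N0 : 0 < INR n) by (apply lt_0_INR; lia).
  assert (T := coefficient_bound _ q (1 - alpha) n Hq).
  cbv beta in T; rewrite Cmod_mult, Cmod_INR in T.
  apply Rmult_le_reg_l with (INR n); auto.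
  replace (INR n * (2 * (1 - alpha) / INR n)) with (2 * (1 - alpha)) by (field; lra).
  apply T; auto.
  intros z Hz Z0; specialize (Hs z Hz Z0); rewrite E in Hs by auto; lra.
Qed.

(** The two functions q of [angular_quotient_series] have the same real
    part, so [coefficient_bound] applies to their difference with every
    positive beta. *)
Lemma coefficient_difference_unique (f h g h0 g0 : C -> C) (a b a0 b0 : nat -> C) (n : nat) :
  log_harmonic_rep f h g a b -> log_harmonic_rep f h0 g0 a0 b0 -> (1 <= n)%nat ->
  (a n - b n = a0 n - b0 n)%C.
Proof.
  intros H H0 Hn.
  destruct (angular_quotient_series _ _ _ _ _ H) as [q [Hq E]].
  destruct (angular_quotient_series _ _ _ _ _ H0) as [q0 [Hq0 E0]].
  set (c := fun n => (INR n * (a n - b n) - INR n * (a0 n - b0 n))%C).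
  assert (Hc : sums_on_disk c (fun z => q z + (-1) * q0 z)%C).
  { intros z Hz.
    eapply is_Cseries_ext;
      [|apply (is_Cseries_plus _ _ _ _ (Hq z Hz) (is_Cseries_scal (-1) _ _ (Hq0 z Hz)))].
    intros k; unfold c; simpl; ring. }
  assert (B : Cmod (c n) <= 0).
  { apply le_epsilon; intros eps He.
    replace (0 + eps) with (2 * (eps / 2)) by field.
    apply (coefficient_bound c _ (eps / 2) n Hc); auto.
    intros z Hz Z0.
    assert (X : Re (q z) = Re (q0 z)).
    { assert (X := E z Hz Z0); rewrite E0 in X by auto; lra. }
    replace (Re (q z + (-1) * q0 z)%C) with (Re (q z) - Re (q0 z))
      by (unfold Re; simpl; ring).
    lra. }
  assert (C0 : c n = 0).
  { apply Cmod_eq_0, Rle_antisym; [auto|apply Cmod_ge_0]. }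
  assert (N0 : INR n <> 0) by (apply not_0_INR; lia).
  assert (N1 : RtoC (INR n) <> RtoC 0) by (intros X; apply N0; injection X; auto).
  replace (a n - b n)%C with (c n / INR n + (a0 n - b0 n))%C
    by (unfold c; field; auto).
  rewrite C0; field; auto.
Qed.

(** * A monotone quantity on triangles *)

(** Up to an additive constant this is log |f_alpha(z)| for
    kappa = 2 (1 - alpha), in terms of the angles gamma = arg z and
    delta = - arg (1 - z). By the law of sines
    |z| = sin delta / sin (gamma + delta) and
    |1 - z| = sin gamma / sin (gamma + delta). *)
Definition log_radius (kappa gamma delta : R) : R :=
  ln (sin delta) + (1 - kappa) * ln (sin (gamma + delta))
  - (2 - kappa) * ln (sin gamma) + kappa * (sin (gamma + 2 * delta) / sin gamma).

(** The derivative of [log_radius] along gamma + kappa delta = const, with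
    a, b = sin, cos of gamma and c, d = sin, cos of delta. The factor s / a,
    where s = sin (gamma + 2 delta), is Re ((1 + z)/(1 - z)). The other one is
    cot delta - (1 - k)^2 cot (gamma + delta) + k^2 cot gamma, the derivative
    of log |z (1 - z)^(-k)|, written as a sum of two squares by completing the
    square in k; its discriminant is negative because the cotangents of the
    angles of a triangle satisfy
    cot A cot B + cot B cot C + cot C cot A = 1. *)
Lemma slope_identity (k a b c d : R) :
  a * a = 1 - b * b -> c * c = 1 - d * d -> 
  a <> 0 -> c <> 0 -> a * d + b * c <> 0 ->
  let s := a * (d * d - c * c) + b * (2 * c * d) in
  let s' := b * (d * d - c * c) - a * (2 * c * d) in
  d / c + (1 - k) * ((1 - k) * (b * d - a * c) / (a * d + b * c))
  + (2 - k) * (k * b / a)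
  + k * (((2 - k) * s' * a + k * b * s) / (a * a)) =
  (s / a) *
  (((c * k + a * (b * d - a * c)) ^ 2 + a ^ 2 * (a * d + b * c) ^ 2)
     / (a * c * (a * d + b * c))).
Proof.
  intros Ha Hc Ha0 Hc0 H0 s s'; unfold s, s'.
  field_simplify_eq; [|auto].
  ring [Ha Hc].
Qed.

(** The region is convex, so the segment between two points with equal
    argument stays inside it, and there [slope_identity] shows a positive
    derivative. *)
Lemma log_radius_increasing (k g1 d1 g2 d2 : R) :
  0 < k <= 2 ->
  0 < g1 -> 0 < d1 -> g1 + 2 * d1 < PI ->
  0 < g2 -> 0 < d2 -> g2 + 2 * d2 < PI ->
  g1 + k * d1 = g2 + k * d2 -> d1 < d2 ->
  log_radius k g1 d1 < log_radius k g2 d2.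
Proof.
  intros Hk Hg1 Hd1 H1 Hg2 Hd2 H2 E Hd.
  set (gam := fun s => g1 - k * (s - d1)).
  assert (T : forall s, d1 <= s <= d2 -> 0 < gam s /\ gam s + 2 * s < PI).
  { intros s Hs; unfold gam.
    assert (0 <= k * (d2 - s)) by (apply Rmult_le_pos; lra).
    assert (0 <= (2 - k) * (d2 - s)) by (apply Rmult_le_pos; lra).
    split; lra. }
  set (slope := fun s =>
    (sin (gam s + 2 * s) / sin (gam s)) *
    (((sin s * k + sin (gam s) * cos (gam s + s)) ^ 2
       + sin (gam s) ^ 2 * sin (gam s + s) ^ 2)
     / (sin (gam s) * sin s * sin (gam s + s)))).
  assert (P : forall s, d1 <= s <= d2 -> 0 < sin (gam s) /\ 0 < sin s /\
     0 < sin (gam s + s) /\ 0 < sin (gam s + 2 * s)).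
  { intros s Hs; destruct (T s Hs); repeat split; apply sin_gt_0; lra. }
  assert (D : forall s, d1 <= s <= d2 ->
     is_derive (fun s => log_radius k (gam s) s) s (slope s)).
  { intros s Hs; destruct (P s Hs) as [P1 [P2 [P3 P4]]].
    unfold log_radius, slope, gam in *; auto_derive;
      change (g1 + - (k * (s + - d1))) with (g1 - k * (s - d1));
      set (g := g1 - k * (s - d1)) in *.
    - repeat split; lra.
    - assert (A := sin2_cos2 g); assert (B := sin2_cos2 s); unfold Rsqr in A, B.
      assert (S1 : sin (g + s) = sin g * cos s + cos g * sin s) by apply sin_plus.
      assert (S2 : cos (g + s) = cos g * cos s - sin g * sin s) by apply cos_plus.
      assert (S3 : sin (g + 2 * s) =
         sin g * (cos s * cos s - sin s * sin s) + cos g * (2 * sin s * cos s)).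
      { rewrite sin_plus, sin_2a, cos_2a; ring. }
      assert (S4 : cos (g + 2 * s) =
         cos g * (cos s * cos s - sin s * sin s) - sin g * (2 * sin s * cos s)).
      { rewrite cos_plus, sin_2a, cos_2a; ring. }
      assert (I := slope_identity k (sin g) (cos g) (sin s) (cos s)
        ltac:(lra) ltac:(lra) ltac:(lra) ltac:(lra) ltac:(lra)).
      cbv zeta in I; rewrite <- S1, <- S2, <- S3, <- S4 in I; rewrite <- I.
      field; repeat split; lra. }
  destruct (MVT_gen (fun s => log_radius k (gam s) s) d1 d2 slope) as [s [Hs Es]].
  - intros s Hs; rewrite Rmin_left, Rmax_right in Hs by lra; apply D; lra.
  - intros s Hs; rewrite Rmin_left, Rmax_right in Hs by lra.
    apply derivable_continuous_pt; exists (slope s); apply is_derive_Reals, D; lra.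
  - rewrite Rmin_left, Rmax_right in Hs by lra.
    destruct (P s Hs) as [P1 [P2 [P3 P4]]].
    assert (Q : 0 < slope s).
    { unfold slope; apply Rmult_lt_0_compat; [now apply Rdiv_lt_0_compat|].
      apply Rdiv_lt_0_compat.
      - apply Rplus_le_lt_0_compat; [apply pow2_ge_0|].
        apply Rmult_lt_0_compat; apply pow_lt; auto.
      - repeat apply Rmult_lt_0_compat; auto. }
    replace (gam d1) with g1 in Es by (unfold gam; ring).
    replace (gam d2) with g2 in Es by (unfold gam; lra).
    nra.
Qed.

(** * Polar form of the extremal function *)

Lemma Re_1_minus_pos (z : C) : in_disk z -> 0 < 1 - Re z.
Proof.
  unfold in_disk; intros H; assert (T := re_le_Cmod z); assert (T' := Rle_abs (Re z)); lra.
Qed.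

Lemma Cmod_sqr (z : C) : Cmod z * Cmod z = Re z * Re z + Im z * Im z.
Proof. assert (T := Cmod2_alt z); simpl in T; lra. Qed.

(** On the right half plane the argument is smooth; the arctangent makes
    this visible, whereas the arccosine formula hides it on the real axis. *)
Lemma Carg_atan (w : C) : 0 < Re w -> Carg w = atan (Im w / Re w).
Proof.
  intros H; unfold Carg.
  set (t := Im w / Re w).
  assert (M : Cmod w = Re w * sqrt (1 + t²)).
  { assert (S := Cmod_sqr w).
    apply Rsqr_inj; [apply Cmod_ge_0|apply Rmult_le_pos; [lra|apply sqrt_pos]|].
    rewrite Rsqr_mult, Rsqr_sqrt.
    - unfold Rsqr, t; rewrite S; field; lra.
    - assert (T := Rle_0_sqr t); lra. }
  assert (S0 : 0 < sqrt (1 + t²)).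
  { apply sqrt_lt_R0; assert (T := Rle_0_sqr t); lra. }
  assert (E : Re w / Cmod w = cos (atan t)).
  { rewrite cos_atan, M; field; split; lra. }
  rewrite E.
  destruct (atan_bound t) as [B1 B2].
  destruct (Rle_dec 0 (Im w)) as [I|I].
  - apply acos_cos; split; [|lra].
    rewrite <- atan_0; destruct (Req_dec t 0) as [->|T0]; [lra|].
    apply Rlt_le, atan_increasing.
    assert (0 <= t) by (apply Rdiv_le_0_compat; auto). lra.
  - rewrite <- cos_neg, acos_cos; [ring|].
    assert (t < 0).
    { unfold t, Rdiv; assert (0 < / Re w) by now apply Rinv_0_lt_compat. nra. }
    assert (atan t < atan 0) by now apply atan_increasing.
    rewrite atan_0 in *; lra.
Qed.

(** The angle - arg (1 - z), which is the angle at 1 of the triangle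
    0, 1, z. *)
Definition tilt (z : C) : R := atan (Im z / (1 - Re z)).

Lemma Clog_1_minus (z : C) :
  in_disk z -> Clog (1 - z)%C = (ln (Cmod (1 - z)%C), - tilt z).
Proof.
  intros Hz; assert (H := Re_1_minus_pos z Hz).
  unfold Clog, tilt; f_equal.
  assert (E : Re (1 - z)%C = 1 - Re z) by reflexivity.
  rewrite Carg_atan by (rewrite E; lra).
  rewrite E, <- atan_opp; f_equal.
  replace (Im (1 - z)%C) with (- Im z) by (unfold Im; simpl; ring).
  field; lra.
Qed.

(** log |f_alpha(z) / z|. *)
Definition growth (alpha : R) (z : C) : R :=
  - (2 * alpha) * ln (Cmod (1 - z)%C) + 4 * (1 - alpha) * Re (z / (1 - z))%C.

Lemma one_minus_neq_0 (z : C) : in_disk z -> (1 - z)%C <> RtoC 0.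
Proof.
  intros Hz E; apply (f_equal Re) in E.
  change (1 - Re z = 0) in E; assert (H := Re_1_minus_pos z Hz); lra.
Qed.

Lemma Cexp_opp (u : C) : Cexp (- u) = (/ Cexp u)%C.
Proof.
  assert (H := Cexp_neq_0 u).
  assert (E : (Cexp u * Cexp (- u))%C = 1).
  { rewrite <- Cexp_plus; replace (u + - u)%C with (RtoC 0) by ring.
    unfold Cexp; simpl; rewrite exp_0, cos_0, sin_0; unfold RtoC; f_equal; ring. }
  rewrite <- (Cmult_1_l (/ Cexp u)), <- E; field; auto.
Qed.

(** The modulus part of f_alpha contributes no argument, so the argument
    of f_alpha(z) / z comes from (1 - z)^(-2 (1 - alpha)) alone. *)
Lemma f_extremal_polar (alpha : R) (z : C) :
  in_disk z ->
  f_extremal alpha z =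
    (z * polar (exp (growth alpha z)) (2 * (1 - alpha) * tilt z))%C.
Proof.
  intros Hz; unfold f_extremal, Cpower.
  rewrite Clog_1_minus by auto.
  set (l := ln (Cmod (1 - z)%C)).
  rewrite Cmod_mult, !Cmod_Cexp.
  unfold Cdiv at 1; rewrite <- Cexp_opp, <- exp_plus.
  rewrite <- Cmult_assoc; f_equal.
  replace (exp _ ^ 2) with
    (exp (2 * ((1 - 2 * alpha) * l + 2 * (1 - alpha) * Re (z / (1 - z))%C))).
  2:{ rewrite <- Rplus_diag, exp_plus.
      replace (Re (RtoC (1 - 2 * alpha) * (l, (- tilt z)%R))%C) with ((1 - 2 * alpha) * l)
        by (unfold Re; simpl; ring).
      replace (Re (RtoC (2 * (1 - alpha)) * (z / (1 - z)))%C)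
        with (2 * (1 - alpha) * Re (z / (1 - z))%C)
        by (unfold Re; simpl; ring).
      ring. }
  unfold Cexp.
  replace (Im (- (RtoC (2 * (1 - alpha)) * (l, (- tilt z)%R)))%C) with
    (2 * (1 - alpha) * tilt z) by (unfold Im; simpl; ring).
  replace (Re (- (RtoC (2 * (1 - alpha)) * (l, (- tilt z)%R)))%C) with
    (- (2 * (1 - alpha) * l)) by (unfold Re; simpl; ring).
  set (p := Re (z / (1 - z))%C).
  unfold polar, growth; fold l; fold p.
  replace (- (2 * alpha) * l + 4 * (1 - alpha) * p) with
    (- (2 * (1 - alpha) * l) + 2 * ((1 - 2 * alpha) * l + 2 * (1 - alpha) * p)) by ring.
  rewrite exp_plus; unfold Cmult, RtoC; cbn [fst snd]; f_equal; ring.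
Qed.

Lemma ln_sqrt_half (x : R) : 0 < x -> ln (sqrt x) = / 2 * ln x.
Proof.
  intros H; assert (S := sqrt_lt_R0 x H).
  rewrite <- (sqrt_sqrt x) at 2 by lra; rewrite ln_mult by auto; field.
Qed.

(** The triangle 0, 1, z has angles gamma at 0 and [tilt z] at 1. The side
    lengths come from the law of sines, and |z| < 1 says that the angle at 1 is
    smaller than the angle at z, that is gamma + 2 tilt z < PI. *)
Lemma upper_half_angles (z : C) :
  in_disk z -> 0 < Im z ->
  exists gamma : R,
    0 < gamma /\ 0 < tilt z /\ gamma + 2 * tilt z < PI /\
    z = polar (Cmod z) gamma /\
    Cmod z = sin (tilt z) / sin (gamma + tilt z) /\
    Cmod (1 - z)%C = sin gamma / sin (gamma + tilt z) /\
    Re (z / (1 - z))%C = cos (tilt z) * sin (gamma + tilt z) / sin gamma - 1.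
Proof.
  intros Hz Hy.
  assert (Hx := Re_1_minus_pos z Hz); unfold in_disk in Hz.
  set (x := Re z) in *; set (y := Im z) in *.
  set (rho := Cmod z) in *; set (D := Cmod (1 - z)%C).
  assert (S1 : rho * rho = x * x + y * y) by apply Cmod_sqr.
  assert (S2 : D * D = (1 - x) * (1 - x) + y * y).
  { unfold D; rewrite Cmod_sqr; unfold x, y, Re, Im; simpl; ring. }
  assert (R0 : 0 <= rho) by apply Cmod_ge_0.
  assert (D0 : 0 <= D) by apply Cmod_ge_0.
  assert (R1 : 0 < rho) by nra.
  assert (D1 : 0 < D) by nra.
  set (delta := tilt z).
  assert (Hd : 0 < delta < PI / 2).
  { unfold delta, tilt; fold x y; split; [|apply atan_bound].
    rewrite <- atan_0; apply atan_increasing, Rdiv_lt_0_compat; auto. }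
  assert (Ct : cos delta = (1 - x) / D /\ sin delta = y / D).
  { assert (Q : sqrt (1 + (y / (1 - x))²) = D / (1 - x)).
    { apply Rsqr_inj; [apply sqrt_pos|apply Rlt_le, Rdiv_lt_0_compat; auto|].
      rewrite Rsqr_sqrt by (assert (T := Rle_0_sqr (y / (1 - x))); lra).
      unfold Rsqr; apply Rmult_eq_reg_r with ((1 - x) * (1 - x)); [|nra].
      field_simplify; [|lra|lra]. nra. }
    unfold delta, tilt; fold x y; rewrite cos_atan, sin_atan, Q.
    split; field; split; lra. }
  destruct Ct as [Cd Sd].
  set (gamma := acos (x / rho)).
  assert (X1 : -1 < x / rho < 1).
  { split; apply Rmult_lt_reg_r with rho; auto; unfold Rdiv;
      rewrite Rmult_assoc, Rinv_l by lra; nra. }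
  assert (Cg : cos gamma = x / rho) by (apply cos_acos; lra).
  assert (Sg : sin gamma = y / rho).
  { unfold gamma; rewrite sin_acos by lra.
    apply Rsqr_inj; [apply sqrt_pos|apply Rlt_le, Rdiv_lt_0_compat; auto|].
    rewrite Rsqr_sqrt by (unfold Rsqr; nra).
    unfold Rsqr; apply Rmult_eq_reg_r with (rho * rho); [|nra].
    field_simplify; [|lra|lra]. nra. }
  assert (Hg : 0 < gamma < PI).
  { destruct (acos_bound (x / rho)) as [B1 B2]; fold gamma in B1, B2.
    assert (Sg0 : 0 < sin gamma) by (rewrite Sg; apply Rdiv_lt_0_compat; auto).
    split.
    - destruct B1 as [B1|B1]; auto; rewrite <- B1, sin_0 in Sg0; lra.
    - destruct B2 as [B2|B2]; auto; rewrite B2, sin_PI in Sg0; lra. }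
  assert (Sgd : sin (gamma + delta) = y / (rho * D)).
  { rewrite sin_plus, Cg, Sg, Cd, Sd; field; split; lra. }
  assert (Sgd0 : 0 < sin (gamma + delta)).
  { rewrite Sgd; apply Rdiv_lt_0_compat; auto; now apply Rmult_lt_0_compat. }
  exists gamma; repeat split; try lra.
  - apply Rnot_le_lt; intros HP.
    assert (B : gamma + delta < PI).
    { apply Rnot_le_lt; intros HP'.
      assert (T := sin_le_0 (gamma + delta) HP' ltac:(lra)); lra. }
    (* If gamma + 2 delta >= PI, then sin (gamma + delta) <= sin delta because the
       sine decreases on [PI/2, PI]; this would make |z| at least 1. *)
    assert (T : sin (gamma + delta) <= sin (PI - delta)).
    { apply sin_decr_1; lra. }
    rewrite sin_PI_x, Sgd, Sd in T.
    apply Rmult_le_compat_r with (r := D) in T; [|lra].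
    replace (y / (rho * D) * D) with (y / rho) in T by (field; lra).
    replace (y / D * D) with y in T by (field; lra).
    apply Rmult_le_compat_r with (r := rho) in T; [|lra].
    replace (y / rho * rho) with y in T by (field; lra). nra.
  - unfold polar; rewrite Cg, Sg; apply injective_projections; cbn [fst snd];
      [change (fst z) with x|change (snd z) with y]; field; lra.
  - rewrite Sgd, Sd; field; repeat split; lra.
  - rewrite Sgd, Sg; field; repeat split; lra.
  - rewrite Sgd, Sg, Cd.
    replace (Re (z / (1 - z))%C) with ((1 - x) / (D * D) - 1).
    { field; repeat split; lra. }
    rewrite S2; unfold x, y, Re, Im, Cdiv, Cinv, Cmult, Cminus, Copp, Cplus, RtoC in *.
    destruct z as [p q]; cbn [fst snd] in *.
    field; nra.
Qed.

Lemma f_extremal_upper (alpha : R) (z : C) :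
  in_disk z -> 0 < Im z ->
  exists gamma : R,
    0 < gamma /\ 0 < tilt z /\ gamma + 2 * tilt z < PI /\
    z = polar (Cmod z) gamma /\
    Cmod z = sin (tilt z) / sin (gamma + tilt z) /\
    f_extremal alpha z =
      polar (exp (log_radius (2 * (1 - alpha)) gamma (tilt z) - 2 * (1 - alpha)))
        (gamma + 2 * (1 - alpha) * tilt z).
Proof.
  intros Hz Hy.
  destruct (upper_half_angles z Hz Hy) as [g [G0 [T0 [GT [Ez [Er [Ed Eq]]]]]]].
  exists g; repeat split; auto.
  set (t := tilt z) in *.
  assert (P1 : 0 < sin g) by (apply sin_gt_0; lra).
  assert (P2 : 0 < sin t) by (apply sin_gt_0; lra).
  assert (P3 : 0 < sin (g + t)) by (apply sin_gt_0; lra).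
  assert (R : exp (log_radius (2 * (1 - alpha)) g t - 2 * (1 - alpha)) =
     Cmod z * exp (growth alpha z)).
  { assert (Z0 : 0 < Cmod z) by (rewrite Er; now apply Rdiv_lt_0_compat).
    rewrite <- (exp_ln (Cmod z)) at 1 by auto; rewrite <- exp_plus; f_equal.
    unfold growth; rewrite Ed, Er, Eq, !ln_div by auto; unfold log_radius.
    replace (sin (g + 2 * t)) with (2 * cos t * sin (g + t) - sin g).
    { field; lra. }
    replace (g + 2 * t) with ((g + t) + t) by ring.
    replace (sin g) with (sin ((g + t) - t)) by (f_equal; ring).
    rewrite (sin_plus (g + t) t), (sin_minus (g + t) t); ring. }
  rewrite f_extremal_polar, R by auto; fold t; rewrite Ez at 1.
  unfold polar, Cmult; cbn [fst snd]; rewrite cos_plus, sin_plus; f_equal; ring.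
Qed.

Lemma polar_inj_upper (r r' t t' : R) :
  0 < r -> 0 < r' -> 0 < t < PI -> 0 < t' < PI -> polar r t = polar r' t' -> r = r' /\ t = t'.
Proof.
  intros Hr Hr' Ht Ht' E.
  assert (Er : r = r').
  { rewrite <- (Cmod_polar r t), <- (Cmod_polar r' t'), E by lra; reflexivity. }
  split; auto; subst r'.
  injection E; intros _ Ec; apply Rmult_eq_reg_l in Ec; [|lra].
  rewrite <- (acos_cos t), <- (acos_cos t'), Ec by lra; reflexivity.
Qed.

(** Equal arguments put both points on one segment
    gamma + kappa delta = const, on which equal moduli force equal points. *)
Lemma f_extremal_inj_upper (alpha : R) (z w : C) :
  0 <= alpha < 1 -> in_disk z -> in_disk w -> 0 < Im z -> 0 < Im w ->
  f_extremal alpha z = f_extremal alpha w -> z = w.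
Proof.
  intros Ha Hz Hw Iz Iw E.
  destruct (f_extremal_upper alpha z Hz Iz) as [g [G1 [G2 [G3 [G4 [G5 G6]]]]]].
  destruct (f_extremal_upper alpha w Hw Iw) as [g' [K1 [K2 [K3 [K4 [K5 K6]]]]]].
  rewrite G6, K6 in E.
  set (k := 2 * (1 - alpha)) in *.
  assert (Hk : 0 < k <= 2) by (unfold k; lra).
  assert (B1 : 0 < k * tilt z <= 2 * tilt z) by nra.
  assert (B2 : 0 < k * tilt w <= 2 * tilt w) by nra.
  apply polar_inj_upper in E; try apply exp_pos; try lra.
  destruct E as [E1 E2]; apply exp_inv in E1.
  assert (T : tilt z = tilt w).
  { destruct (Rtotal_order (tilt z) (tilt w)) as [L|[L|L]]; auto.
    - assert (I := log_radius_increasing k g (tilt z) g' (tilt w)); lra.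
    - assert (I := log_radius_increasing k g' (tilt w) g (tilt z)); lra. }
  assert (Eg : g = g') by (rewrite T in E2; lra).
  rewrite G4, K4, G5, K5, T, Eg; reflexivity.
Qed.

(** * Univalence of the extremal function *)

Lemma in_disk_conj (z : C) : in_disk z -> in_disk (Cconj z).
Proof. unfold in_disk; now rewrite Cmod_conj. Qed.

Lemma f_extremal_conj (alpha : R) (z : C) :
  in_disk z -> f_extremal alpha (Cconj z) = Cconj (f_extremal alpha z).
Proof.
  intros Hz; rewrite !f_extremal_polar by auto using in_disk_conj.
  assert (N := one_minus_neq_0 z Hz).
  assert (E1 : (1 - Cconj z)%C = Cconj (1 - z)).
  { rewrite Cminus_conj, Cconj_RtoC; reflexivity. }
  assert (G : growth alpha (Cconj z) = growth alpha z).
  { unfold growth; rewrite E1, Cmod_conj, <- Cdiv_conj, re_conj by auto; reflexivity. }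
  assert (T : tilt (Cconj z) = - tilt z).
  { unfold tilt; rewrite re_conj, im_conj, <- atan_opp; f_equal; unfold Rdiv; ring. }
  rewrite G, T, Cmult_conj; f_equal.
  unfold polar, Cconj; cbn [fst snd].
  replace (2 * (1 - alpha) * - tilt z) with (- (2 * (1 - alpha) * tilt z)) by ring.
  rewrite cos_neg, sin_neg; f_equal; ring.
Qed.

Lemma f_extremal_Im_pos (alpha : R) (z : C) :
  0 <= alpha < 1 -> in_disk z -> 0 < Im z -> 0 < Im (f_extremal alpha z).
Proof.
  intros Ha Hz Iz.
  destruct (f_extremal_upper alpha z Hz Iz) as [g [G1 [G2 [G3 [G4 [G5 G6]]]]]].
  rewrite G6; unfold polar, Im; cbn [snd].
  apply Rmult_lt_0_compat; [apply exp_pos|apply sin_gt_0]; nra.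
Qed.

Lemma f_extremal_Im_neg (alpha : R) (z : C) :
  0 <= alpha < 1 -> in_disk z -> Im z < 0 -> Im (f_extremal alpha z) < 0.
Proof.
  intros Ha Hz Iz.
  assert (P := f_extremal_Im_pos alpha (Cconj z) Ha (in_disk_conj z Hz)).
  rewrite f_extremal_conj, !im_conj in P by auto; lra.
Qed.

(** The restriction of f_alpha to the real diameter. *)
Definition real_profile (alpha x : R) : R :=
  x * exp (- (2 * alpha) * ln (1 - x) + 4 * (1 - alpha) * (x / (1 - x))).

Lemma f_extremal_real (alpha x : R) :
  -1 < x < 1 -> f_extremal alpha x = real_profile alpha x.
Proof.
  intros Hx.
  assert (Hz : in_disk x) by (unfold in_disk; rewrite Cmod_R; apply Rabs_def1; lra).
  rewrite f_extremal_polar by auto.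
  assert (T : tilt x = 0).
  { unfold tilt; simpl; replace (0 / (1 - x)) with 0 by (field; lra); apply atan_0. }
  assert (G : growth alpha x = - (2 * alpha) * ln (1 - x) + 4 * (1 - alpha) * (x / (1 - x))).
  { unfold growth.
    assert (E : (1 - x)%C = RtoC (1 - x)) by (rewrite RtoC_minus; reflexivity).
    rewrite E, Cmod_R, Rabs_pos_eq by lra.
    replace (x / RtoC (1 - x))%C with (RtoC (x / (1 - x)));
      [reflexivity|apply RtoC_div; lra]. }
  unfold real_profile; rewrite T, G, Rmult_0_r.
  unfold polar, RtoC, Cmult; cbn [fst snd]; rewrite cos_0, sin_0; f_equal; ring.
Qed.

(** The derivative is a positive multiple of (1 + t) (1 + (1 - 2 alpha) t),
    and both factors are positive on (-1, 1). *)
Lemma real_profile_increasing (alpha x y : R) :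
  0 <= alpha < 1 -> -1 < x -> x < y -> y < 1 -> real_profile alpha x < real_profile alpha y.
Proof.
  intros Ha Hx Hxy Hy.
  set (d := fun t =>
    exp (- (2 * alpha) * ln (1 - t) + 4 * (1 - alpha) * (t / (1 - t)))
      * ((1 + t) * (1 + (1 - 2 * alpha) * t) / (1 - t) ^ 2)).
  assert (D : forall t, -1 < t < 1 -> is_derive (real_profile alpha) t (d t)).
  { intros t Ht; unfold real_profile, d; auto_derive; [split; lra|].
    unfold Rdiv, Rminus; field; lra. }
  destruct (MVT_gen (real_profile alpha) x y d) as [t [Ht E]].
  - intros t Ht; rewrite Rmin_left, Rmax_right in Ht by lra; apply D; lra.
  - intros t Ht; rewrite Rmin_left, Rmax_right in Ht by lra.
    apply derivable_continuous_pt; exists (d t); apply is_derive_Reals, D; lra.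
  - rewrite Rmin_left, Rmax_right in Ht by lra.
    assert (P : 0 < d t).
    { unfold d; apply Rmult_lt_0_compat; [apply exp_pos|].
      apply Rdiv_lt_0_compat; [apply Rmult_lt_0_compat; nra|apply pow_lt; lra]. }
    nra.
Qed.

Lemma Im_0_RtoC (z : C) : Im z = 0 -> z = Re z.
Proof. destruct z; unfold Im, RtoC; simpl; intros ->; reflexivity. Qed.

(** The sign of Im f_alpha(z) is the sign of Im z, so two points with the
    same image lie in the same half disk or both on the real axis. *)
Lemma f_extremal_injective (alpha : R) :
  0 <= alpha < 1 -> univalent_on_disk (f_extremal alpha).
Proof.
  intros Ha.
  assert (Hreal : forall x, in_disk (RtoC x) -> -1 < x < 1).
  { intros x Hx; unfold in_disk in Hx; rewrite Cmod_R in Hx.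
    apply Rabs_def2 in Hx; lra. }
  assert (Im0 : forall x, in_disk (RtoC x) -> Im (f_extremal alpha x) = 0).
  { intros x Hx; rewrite f_extremal_real by auto; reflexivity. }
  intros z w Hz Hw E.
  destruct (Rtotal_order (Im z) 0) as [Iz|[Iz|Iz]];
    destruct (Rtotal_order (Im w) 0) as [Iw|[Iw|Iw]];
    try (apply Im_0_RtoC in Iz; rewrite Iz in *; assert (A := Im0 _ Hz));
    try (apply Im_0_RtoC in Iw; rewrite Iw in *; assert (B := Im0 _ Hw));
    try (assert (P := f_extremal_Im_pos alpha z Ha Hz Iz));
    try (assert (Q := f_extremal_Im_pos alpha w Ha Hw Iw));
    try (assert (P := f_extremal_Im_neg alpha z Ha Hz Iz));
    try (assert (Q := f_extremal_Im_neg alpha w Ha Hw Iw));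
    try (rewrite E in *; lra).
  - rewrite <- (Cconj_conj z), <- (Cconj_conj w); f_equal.
    apply (f_extremal_inj_upper alpha); auto using in_disk_conj;
      rewrite ?im_conj; try lra.
    rewrite !f_extremal_conj, E by auto; reflexivity.
  - assert (X := Hreal _ Hz); assert (Y := Hreal _ Hw).
    rewrite !f_extremal_real in E by auto; injection E; intros E'.
    destruct (Rtotal_order (Re z) (Re w)) as [L|[L|L]].
    + assert (I := real_profile_increasing alpha _ _ Ha (proj1 X) L (proj2 Y)); lra.
    + rewrite L; reflexivity.
    + assert (I := real_profile_increasing alpha _ _ Ha (proj1 Y) L (proj2 X)); lra.
  - now apply (f_extremal_inj_upper alpha).
Qed.

(** * The logarithmic series *)

Lemma RtoC_neq_0 (x : R) : x <> 0 -> RtoC x <> RtoC 0.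
Proof. intros H E; apply H; injection E; auto. Qed.

(** The sum s exists by absolute convergence and satisfies z s = s - 1. *)
Lemma geometric_series (z : C) :
  in_disk z -> is_Cseries (fun n => z ^ n)%C (/ (1 - z))%C.
Proof.
  intros Hz; assert (N := one_minus_neq_0 z Hz).
  destruct (ex_Cseries_le (fun n => z ^ n)%C (fun n => Cmod z ^ n)) as [s Hs].
  { intros n; rewrite Cmod_pow; apply Rle_refl. }
  { apply ex_series_geom; rewrite Rabs_pos_eq by apply Cmod_ge_0; exact Hz. }
  replace (/ (1 - z))%C with s; auto.
  assert (S1 := is_Cseries_scal z _ _ Hs).
  assert (S2 : is_Cseries (fun n => z * z ^ n)%C (s - 1)%C).
  { apply (is_series_incr_1 (K := C_AbsRing) (V := C_NormedModule) (fun n => z ^ n)%C).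
    match goal with |- is_series _ ?l => replace l with s; auto end.
    enough (E : forall v : C, v = (v - 1 + 1)%C) by apply E; intros v; ring. }
  assert (E := is_Cseries_unique _ _ _ S1 S2).
  assert (F : forall v : C, (z * v = v - 1)%C -> v = (/ (1 - z))%C).
  { intros v Hv; transitivity ((v - z * v) * / (1 - z))%C; [field; auto|].
    rewrite Hv; field; auto. }
  now apply F.
Qed.

Lemma is_derive_ray (phi : C -> R) (A : C -> C) (u A' : C) (s : R) :
  Cmod u = 1 -> coordinate phi ->
  is_wirt A (s * u)%C A' 0 ->
  is_derive (fun t : R => phi (A (t * u)%C)) s (phi (A' * u)%C).
Proof.
  intros Hu Hphi H.
  assert (D := is_wirt_slice A (s * u)%C A' 0 u phi H Hu Hphi).
  replace (A' * u + 0 * Cconj u)%C with (A' * u)%C in D by ring.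
  apply is_derive_Reals in D; apply is_derive_Reals.
  intros eps He; destruct (D eps He) as [d Hd]; exists d; intros t Ht Htd.
  specialize (Hd t Ht Htd).
  replace ((s + t)%R * u)%C with (s * u + (0 + t)%R * u)%C
    by (rewrite !RtoC_plus; ring).
  replace (phi (A (s * u)%C)) with (phi (A (s * u + 0 * u)%C)) by (do 2 f_equal; ring).
  exact Hd.
Qed.

Lemma ray_constant (F : R -> R) (x : R) :
  0 <= x -> (forall t, 0 <= t <= x -> is_derive F t 0) -> F x = F 0.
Proof.
  intros Hx D.
  destruct (MVT_gen F 0 x (fun _ => 0)) as [t [_ E]].
  - intros t Ht; rewrite Rmin_left, Rmax_right in Ht by lra; apply D; lra.
  - intros t Ht; rewrite Rmin_left, Rmax_right in Ht by lra.
    apply derivable_continuous_pt; exists 0; apply is_derive_Reals, D; lra.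
  - lra.
Qed.

Lemma sums_on_disk_0 (a : nat -> C) (A : C -> C) : sums_on_disk a A -> A 0 = 0.
Proof.
  intros HA; apply (is_Cseries_unique (fun n => a (S n) * 0 ^ S n)%C).
  - apply HA; unfold in_disk; rewrite Cmod_0; lra.
  - apply is_Cseries_iff; intros eps He; exists 0%nat; intros n _.
    replace (Csum _ n) with (RtoC 0).
    + replace (0 - 0)%C with (RtoC 0) by ring; rewrite Cmod_0; auto.
    + induction n as [|n IH]; [rewrite Csum_0|rewrite Csum_S, <- IH]; rewrite Cpow_S; ring.
Qed.

(** Both sides vanish at 0, and along every ray their real and imaginary
    parts have the same derivative: the termwise derivative of the series is
    1 / (1 - z). Working on rays avoids the differentiability of the complex
    logarithm. *)
Lemma log_series : sums_on_disk (fun n => / INR n)%C (fun z => - Clog (1 - z))%C.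
Proof.
  destruct (sums_on_disk_ex (fun n => / INR n)%C) as [A HA].
  { intros z Hz.
    apply (ex_Cseries_le _ (fun n => Cmod z ^ S n)).
    - intros n; rewrite Cmod_mult, Cmod_pow.
      rewrite <- (Rmult_1_l (Cmod z ^ S n)) at 2.
      apply Rmult_le_compat_r; [apply pow_le, Cmod_ge_0|].
      assert (1 <= INR (S n)) by (rewrite S_INR; assert (T := pos_INR n); lra).
      rewrite Cmod_inv, Cmod_INR by (apply RtoC_neq_0; lra).
      rewrite <- Rinv_1; apply Rinv_le_contravar; lra.
    - apply (ex_series_incr_1 (fun n => Cmod z ^ n)), ex_series_geom.
      rewrite Rabs_pos_eq by apply Cmod_ge_0; exact Hz. }
  assert (W : forall z, in_disk z -> is_wirt A z (/ (1 - z)) 0).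
  { intros z Hz; destruct (power_series_wirt _ A z HA Hz) as [A' [S D]].
    replace (/ (1 - z))%C with A'; auto.
    apply (is_Cseries_unique (fun n => z ^ n)%C); [|now apply geometric_series].
    eapply is_Cseries_ext; [|exact S].
    intros n; cbv beta.
    assert (RtoC (INR (Datatypes.S n)) <> RtoC 0).
    { apply RtoC_neq_0, not_0_INR; lia. }
    field; auto. }
  assert (A0 := sums_on_disk_0 _ _ HA).
  intros z Hz.
  replace (- Clog (1 - z))%C with (A z); [now apply HA|].
  rewrite Clog_1_minus by auto.
  destruct (Req_dec (Cmod z) 0) as [Z0|Z0].
  { apply Cmod_eq_0 in Z0; subst z; rewrite A0.
    replace (1 - 0)%C with (RtoC 1) by ring.
    unfold tilt; simpl; rewrite Cmod_1, ln_1.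
    replace (0 / (1 - 0)) with 0 by field; rewrite atan_0.
    unfold RtoC, Copp; simpl; f_equal; ring. }
  set (r := Cmod z) in *.
  assert (R0 : 0 < r) by (assert (T := Cmod_ge_0 z); unfold r in *; lra).
  set (u := (z / r)%C).
  assert (Rn : RtoC r <> RtoC 0) by (apply RtoC_neq_0; lra).
  assert (Ez : z = (r * u)%C) by (unfold u; field; auto).
  assert (Hu : Cmod u = 1).
  { unfold u; rewrite Cmod_div, Cmod_R, Rabs_pos_eq by (auto; lra); fold r; field; lra. }
  assert (U1 := Cmod_sqr u); rewrite Hu in U1.
  unfold in_disk in Hz; fold r in Hz.
  set (p := Re u) in *; set (q := Im u) in *.
  assert (P1 : -1 <= p <= 1) by (split; nra).
  destruct Re_coordinate as [_ [_ L3]]; destruct Im_coordinate as [_ [_ M3]].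
  assert (Hray : forall t, 0 <= t <= r -> is_wirt A (t * u)%C (/ (1 - t * u)) 0).
  { intros t Ht; apply W; unfold in_disk; rewrite Cmod_mult, Hu, Cmod_R, Rabs_pos_eq; lra. }
  assert (Pos : forall t, 0 <= t <= r -> 0 < 1 - t * p /\ 0 < (1 - t * p) ^ 2 + (t * q) ^ 2).
  { intros t Ht; assert (0 < 1 - t * p) by nra; split; auto.
    apply Rplus_lt_le_0_compat; [now apply pow_lt|apply pow2_ge_0]. }
  assert (Q : forall t, 0 <= t <= r ->
    (/ (1 - t * u) * u)%C =
      ((p - t) / ((1 - t * p) ^ 2 + (t * q) ^ 2),
       q / ((1 - t * p) ^ 2 + (t * q) ^ 2))).
  { intros t Ht; destruct (Pos t Ht) as [Q1 Q2].
    unfold p, q, Re, Im in *; clearbody u; destruct u as [p' q']; cbn [fst snd] in *.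
    unfold Cinv, Cmult, Cminus, Cplus, Copp, RtoC; cbn [fst snd].
    f_equal.
    - replace (p' - t) with (p' - t * (p' * p' + q' * q')) by nra.
      field; nra.
    - field; nra. }
  apply injective_projections.
  - change (Re (A z) = - ln (Cmod (1 - z)%C)).
    assert (Em : forall t : R, Cmod (1 - t * u)%C = sqrt ((1 - t * p) ^ 2 + (t * q) ^ 2)).
    { intros t; unfold p, q, Re, Im, Cmod; destruct u; simpl; f_equal; ring. }
    rewrite Ez, Em.
    assert (C := ray_constant
      (fun t => Re (A (t * u)%C) + / 2 * ln ((1 - t * p) ^ 2 + (t * q) ^ 2)) r).
    cbv beta in C; rewrite ln_sqrt_half by (apply Pos; lra).
    replace (0 * u)%C with (RtoC 0) in C by ring.
    rewrite A0 in C; change (Re 0) with 0 in C.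
    replace ((1 - 0 * p) ^ 2 + (0 * q) ^ 2) with 1 in C by ring; rewrite ln_1 in C.
    rewrite <- (Rplus_0_r (Re (A (r * u)%C))).
    assert (Re (A (r * u)%C) + / 2 * ln ((1 - r * p) ^ 2 + (r * q) ^ 2) = 0 + / 2 * 0);
      [|lra].
    apply C; [lra|].
    intros t Ht; destruct (Pos t Ht) as [Q1 Q2].
    assert (D := is_derive_ray Re A u _ t Hu Re_coordinate (Hray t Ht)).
    rewrite (Q t Ht) in D; cbn [Re fst] in D.
    assert (D2 : is_derive (fun t => / 2 * ln ((1 - t * p) ^ 2 + (t * q) ^ 2)) t
       (- ((p - t) / ((1 - t * p) ^ 2 + (t * q) ^ 2)))).
    { auto_derive; [simpl in *; lra|].
      assert (E : t = t * (p * p + q * q)) by nra.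
      replace (p - t) with (p - t * (p * p + q * q)) by lra.
      field. simpl in *; lra. }
    assert (D3 := is_derive_plus _ _ _ _ _ D D2).
    eapply is_derive_ext; [|eapply eq_ind; [apply D3|]]; [intros; reflexivity|].
    unfold plus, Re; simpl; ring.
  - change (Im (A z) = - - tilt z).
    assert (Em : forall t : R, tilt (t * u)%C = atan (t * q / (1 - t * p))).
    { intros t; unfold tilt; rewrite L3, M3; reflexivity. }
    rewrite Ez, Em.
    assert (C := ray_constant
      (fun t => Im (A (t * u)%C) - atan (t * q / (1 - t * p))) r).
    cbv beta in C.
    replace (0 * u)%C with (RtoC 0) in C by ring.
    rewrite A0 in C; change (Im 0) with 0 in C.
    replace (0 * q / (1 - 0 * p)) with 0 in C by field; rewrite atan_0 in C.
    assert (Im (A (r * u)%C) - atan (r * q / (1 - r * p)) = 0 - 0); [|lra].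
    apply C; [lra|].
    intros t Ht; destruct (Pos t Ht) as [Q1 Q2].
    assert (D := is_derive_ray Im A u _ t Hu Im_coordinate (Hray t Ht)).
    rewrite (Q t Ht) in D; cbn [Im snd] in D.
    assert (D2 : is_derive (fun t => atan (t * q / (1 - t * p))) t
       (q / ((1 - t * p) ^ 2 + (t * q) ^ 2))).
    { auto_derive; [lra|].
      field; repeat split; simpl in *; lra. }
    assert (D3 := is_derive_minus _ _ _ _ _ D D2).
    eapply is_derive_ext; [|eapply eq_ind; [apply D3|]]; [intros; reflexivity|].
    unfold minus, plus, opp, Im; simpl; ring.
Qed.

(** * The extremal function and its rotations *)

Lemma ex_derive_Cexp_sums (a : nat -> C) (A : C -> C) (z : C) :
  sums_on_disk a A -> in_disk z ->
  ex_derive (K := C_AbsRing) (V := C_NormedModule) (fun w => Cexp (A w)) z.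
Proof.
  intros HA Hz; destruct (power_series_wirt a A z HA Hz) as [A' [_ W]].
  apply (ex_derive_wirt _ _ (Cexp (A z) * A')%C).
  eapply is_wirt_eq; [apply (is_wirt_Cexp _ _ _ _ W)|reflexivity|ring].
Qed.

Lemma log_harmonic_rep_of_sums (f A B : C -> C) (a b : nat -> C) :
  sums_on_disk a A -> sums_on_disk b B ->
  (forall w, in_disk w -> f w = (w * Cexp (A w) * Cconj (Cexp (B w)))%C) ->
  log_harmonic_rep f (fun w => Cexp (A w)) (fun w => Cexp (B w)) a b.
Proof.
  intros HA HB Hf.
  assert (E0 : Cexp 0 = 1).
  { unfold Cexp; simpl; rewrite exp_0, cos_0, sin_0; unfold RtoC; f_equal; ring. }
  repeat split.
  - intros z Hz; now apply (ex_derive_Cexp_sums a).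
  - intros z Hz; now apply (ex_derive_Cexp_sums b).
  - now rewrite (sums_on_disk_0 a A HA).
  - now rewrite (sums_on_disk_0 b B HB).
  - intros z Hz; exists (A z); auto.
  - intros z Hz; exists (B z); auto.
  - exact Hf.
Qed.

(** With p = 1 these are the Taylor coefficients of log h, and with
    p = - (1 - 2 alpha) those of log g, for the extremal function rotated by
    [eta]. *)
Definition rotation_coeff (alpha p : R) (eta : C) (n : nat) : C :=
  ((p / INR n + 2 * (1 - alpha)) * eta ^ n)%C.

Definition rotation_log (alpha p : R) (eta z : C) : C :=
  (p * - Clog (1 - eta * z) + 2 * (1 - alpha) * (eta * z / (1 - eta * z)))%C.

Lemma in_disk_rotation (eta z : C) : Cmod eta = 1 -> in_disk z -> in_disk (eta * z).
Proof. unfold in_disk; intros He Hz; rewrite Cmod_mult, He; lra. Qed.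

Lemma rotation_sums (alpha p : R) (eta : C) :
  Cmod eta = 1 -> sums_on_disk (rotation_coeff alpha p eta) (rotation_log alpha p eta).
Proof.
  intros He z Hz; assert (Hw := in_disk_rotation eta z He Hz).
  assert (S1 := is_Cseries_scal p _ _ (log_series _ Hw)).
  assert (S2 := is_Cseries_scal (2 * (1 - alpha) * (eta * z))%C _ _ (geometric_series _ Hw)).
  assert (S := is_Cseries_plus _ _ _ _ S1 S2).
  unfold rotation_log, Cdiv; rewrite (Cmult_assoc (2 * (1 - alpha))).
  eapply is_Cseries_ext; [|exact S].
  intros n; cbv beta; unfold rotation_coeff, Cdiv.
  rewrite Cpow_mult_l, (Cpow_mult_l eta z n), !Cpow_S; ring.
Qed.

(** The factor 1 / (1 - w)^(2 (1 - alpha)) turns one of the two factors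
    exp (B) of the squared modulus into exp (A), because
    2 (1 - alpha) - (1 - 2 alpha) = 1. *)
Lemma f_extremal_factor (alpha : R) (w : C) :
  f_extremal alpha w =
    (w * Cexp (rotation_log alpha 1 1 w) *
       Cconj (Cexp (rotation_log alpha (- (1 - 2 * alpha)) 1 w)))%C.
Proof.
  unfold f_extremal, Cpower, rotation_log.
  rewrite !Cmult_1_l.
  set (l := Clog (1 - w)%C); set (t := (w / (1 - w))%C).
  rewrite <- Cexp_plus, Cmod2_conj.
  unfold Cdiv; rewrite <- Cexp_opp.
  rewrite !RtoC_mult, !RtoC_opp, !RtoC_minus, !RtoC_mult.
  replace (- (1 - 2 * alpha) * - l + 2 * (1 - alpha) * t)%C with
    ((1 - 2 * alpha) * l + 2 * (1 - alpha) * t)%C by ring.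
  replace (- l + 2 * (1 - alpha) * t)%C with
    (- (2 * (1 - alpha) * l) + ((1 - 2 * alpha) * l + 2 * (1 - alpha) * t))%C by ring.
  rewrite (Cexp_plus (- _)); ring.
Qed.

Lemma rotation_log_1 (alpha p : R) (eta z : C) :
  rotation_log alpha p 1 (eta * z)%C = rotation_log alpha p eta z.
Proof. unfold rotation_log; now rewrite !Cmult_1_l. Qed.

Lemma Cconj_unit (eta : C) : Cmod eta = 1 -> (Cconj eta * eta = 1)%C.
Proof.
  intros H; rewrite Cmult_comm, <- Cmod2_conj, H; simpl; f_equal; ring.
Qed.

(** The map w / (1 - w) sends the disk onto the half plane Re > - 1/2. *)
Lemma Re_half_plane (w : C) : in_disk w -> - / 2 < Re (w / (1 - w))%C.
Proof.
  intros Hw; assert (N := Re_1_minus_pos w Hw).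
  assert (S := Cmod_sqr w); assert (C0 := Cmod_ge_0 w); unfold in_disk in Hw.
  assert (Q : Re w * Re w + Im w * Im w < 1) by nra.
  clear S C0 Hw; destruct w as [x y]; unfold Re, Im in *; cbn [fst snd] in *.
  assert (D : 0 < (1 - x) ^ 2 + y ^ 2) by (assert (T := pow2_ge_0 y); nra).
  replace (fst _) with (- / 2 + (1 - (x * x + y * y)) / (2 * ((1 - x) ^ 2 + y ^ 2))).
  - assert (0 < (1 - (x * x + y * y)) / (2 * ((1 - x) ^ 2 + y ^ 2)))
      by (apply Rdiv_lt_0_compat; lra). lra.
  - unfold Cdiv, Cinv, Cmult, Cminus, Cplus, Copp, RtoC; cbn [fst snd]; field; nra.
Qed.

(** Here X = z A' and Y = z B', so this says that the dilatation is eta z.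
    It is an identity of coefficients: the n-th coefficient on the left is eta
    times the one of index n - 1 on the right. *)
Lemma dilatation_relation (alpha : R) (eta z : C) (X Y : C) :
  is_Cseries (fun n => INR (S n) * rotation_coeff alpha 1 eta (S n) * z ^ S n)%C X ->
  is_Cseries (fun n => INR (S n) * rotation_coeff alpha (- (1 - 2 * alpha)) eta (S n)
     * z ^ S n)%C Y ->
  Y = (eta * z * (1 + X))%C.
Proof.
  intros HX HY.
  assert (NZ : forall n, RtoC (INR (S n)) <> RtoC 0).
  { intros n; apply RtoC_neq_0, not_0_INR; lia. }
  assert (S1 := is_Cseries_scal (eta * z) _ _ HX).
  assert (S2 : is_Cseries (fun n => INR (S (S n)) *
     rotation_coeff alpha (- (1 - 2 * alpha)) eta (S (S n)) * z ^ S (S n))%C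
     (Y - eta * z)%C).
  { apply (is_series_incr_1 (K := C_AbsRing) (V := C_NormedModule)
      (fun n => INR (S n) * rotation_coeff alpha (- (1 - 2 * alpha)) eta (S n) * z ^ S n)%C).
    match goal with |- is_series _ ?l => replace l with Y; auto end.
    assert (E : (INR 1 * rotation_coeff alpha (- (1 - 2 * alpha)) eta 1 * z ^ 1)%C
      = (eta * z)%C).
    { unfold rotation_coeff; rewrite !Cpow_1_r; change (INR 1) with 1.
      rewrite RtoC_opp, RtoC_minus, RtoC_mult; field. }
    rewrite E.
    enough (F : forall u v : C, u = (u - v + v)%C) by apply F; intros; ring. }
  assert (E : (eta * z * X)%C = (Y - eta * z)%C).
  { apply (is_Cseries_unique _ _ _ S1).
    eapply is_Cseries_ext; [|exact S2].
    intros n; cbv beta; unfold rotation_coeff.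
    rewrite RtoC_opp, RtoC_minus, RtoC_mult, !Cpow_S.
    assert (N1 := NZ n); assert (N2 := NZ (S n)).
    rewrite (RtoC_INR_S (S n)) in *; rewrite (RtoC_INR_S n) in *.
    field; auto. }
  transitivity ((Y - eta * z) + eta * z)%C; [ring|rewrite <- E; ring].
Qed.

(** The terms 2 (1 - alpha) of the two coefficient families cancel, which
    leaves a geometric series. *)
Lemma angular_relation (alpha : R) (eta z : C) (X Y : C) :
  in_disk (eta * z) ->
  is_Cseries (fun n => INR (S n) * rotation_coeff alpha 1 eta (S n) * z ^ S n)%C X ->
  is_Cseries (fun n => INR (S n) * rotation_coeff alpha (- (1 - 2 * alpha)) eta (S n)
     * z ^ S n)%C Y ->
  (X - Y = RtoC (2 * (1 - alpha)) * (eta * z / (1 - eta * z)))%C.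
Proof.
  intros Hw HX HY.
  assert (S1 := is_Cseries_plus _ _ _ _ HX (is_Cseries_scal (-1) _ _ HY)).
  assert (S2 := is_Cseries_scal (RtoC (2 * (1 - alpha)) * (eta * z))%C _ _
    (geometric_series _ Hw)).
  transitivity (X + (-1) * Y)%C; [ring|].
  unfold Cdiv; rewrite (Cmult_assoc (RtoC (2 * (1 - alpha)))).
  apply (is_Cseries_unique _ _ _ S1).
  eapply is_Cseries_ext; [|exact S2].
  intros n; cbv beta; unfold rotation_coeff.
  assert (N1 : RtoC (INR (S n)) <> RtoC 0) by (apply RtoC_neq_0, not_0_INR; lia).
  rewrite RtoC_opp, RtoC_minus, !RtoC_mult, RtoC_minus, Cpow_mult_l, !Cpow_S.
  field; auto.
Qed.

Definition is_rotation (alpha : R) (eta : C) (f : C -> C) : Prop :=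
  Cmod eta = 1 /\
  forall z, in_disk z -> f z = (Cconj eta * f_extremal alpha (eta * z))%C.

Lemma rotation_factor (alpha : R) (eta : C) (f : C -> C) (z : C) :
  is_rotation alpha eta f -> in_disk z ->
  f z = (z * Cexp (rotation_log alpha 1 eta z) *
           Cconj (Cexp (rotation_log alpha (- (1 - 2 * alpha)) eta z)))%C.
Proof.
  intros [Heta Hf] Hz; rewrite Hf, f_extremal_factor, !rotation_log_1 by auto.
  set (E := Cexp _); set (G := Cexp _).
  transitivity ((Cconj eta * eta) * (z * E * Cconj G))%C.
  - ring.
  - rewrite Cconj_unit by auto; ring.
Qed.

Lemma rotation_rep (alpha : R) (eta : C) (f : C -> C) :
  is_rotation alpha eta f ->
  log_harmonic_rep f (fun w => Cexp (rotation_log alpha 1 eta w))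
    (fun w => Cexp (rotation_log alpha (- (1 - 2 * alpha)) eta w))
    (rotation_coeff alpha 1 eta) (rotation_coeff alpha (- (1 - 2 * alpha)) eta).
Proof.
  intros Hf; apply log_harmonic_rep_of_sums; [now apply rotation_sums, Hf..|].
  intros w Hw; now apply rotation_factor.
Qed.

Lemma rotation_log_harmonic (alpha : R) (eta : C) (f : C -> C) :
  is_rotation alpha eta f -> log_harmonic f.
Proof.
  intros Hrot.
  set (A := rotation_log alpha 1 eta).
  set (B := rotation_log alpha (- (1 - 2 * alpha)) eta).
  assert (Hfac : forall z, in_disk z -> f z = (z * Cexp (A z) * Cconj (Cexp (B z)))%C)
    by (intros z Hz; now apply rotation_factor).
  destruct Hrot as [Heta Hf].
  assert (W : forall z, in_disk z -> exists A' B',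
    is_wirt A z A' 0 /\ is_wirt B z B' 0 /\
    (z * B' = eta * z * (1 + z * A'))%C).
  { intros z Hz.
    destruct (derivative_series _ A z (rotation_sums alpha 1 eta Heta) Hz) as [A' [WA SA]].
    destruct (derivative_series _ B z (rotation_sums alpha _ eta Heta) Hz) as [B' [WB SB]].
    exists A', B'; repeat split; auto.
    now apply (dilatation_relation alpha eta z). }
  split.
  - intros z Hz; destruct (W z Hz) as [A' [B' [WA [WB _]]]].
    exact (real_differentiable_wirt _ _ _ _
      (product_wirt f A B z A' B' Hz Hfac WA WB)).
  - exists (fun z => eta * z)%C; repeat split.
    + intros z _; apply (ex_derive_wirt _ _ eta).
      eapply is_wirt_eq;
        [apply (is_wirt_mult _ _ _ _ _ _ _ (is_wirt_const eta z) (is_wirt_id z))|ring|ring].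
    + intros z Hz; now apply in_disk_rotation.
    + intros z Hz F0; destruct (W z Hz) as [A' [B' [WA [WB R]]]].
      assert (P := product_wirt f A B z A' B' Hz Hfac WA WB).
      rewrite (d_z_wirt _ _ _ _ P), (d_zbar_wirt _ _ _ _ P).
      rewrite Hfac in * by auto.
      rewrite !Cmult_conj, !Cconj_conj.
      set (E := Cexp (A z)) in *; set (G := Cexp (B z)) in *.
      assert (E0 : E <> RtoC 0) by apply Cexp_neq_0.
      assert (G0 : Cconj G <> RtoC 0) by apply Cconj_neq_0, Cexp_neq_0.
      assert (Z0 : z <> RtoC 0) by (intros X; apply F0; rewrite X; ring).
      transitivity (Cconj z * Cconj E * G * ((z * B') / z))%C; [field; auto|].
      rewrite R; field; auto.
Qed.

Lemma rotation_univalent (alpha : R) (eta : C) (f : C -> C) :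
  0 <= alpha < 1 -> is_rotation alpha eta f -> univalent_on_disk f.
Proof.
  intros Halpha [Heta Hf].
  assert (U : forall u v : C, (eta * u = eta * v)%C -> u = v).
  { intros u v E.
    rewrite <- (Cmult_1_l u), <- (Cmult_1_l v), <- (Cconj_unit eta Heta).
    rewrite <- !Cmult_assoc, E; reflexivity. }
  intros z w Hz Hw E; rewrite !Hf in E by auto.
  apply U, (f_extremal_injective alpha Halpha); auto using in_disk_rotation.
  rewrite <- (Cmult_1_l (f_extremal alpha (eta * z)%C)),
    <- (Cmult_1_l (f_extremal alpha (eta * w)%C)), <- (Cconj_unit eta Heta).
  rewrite (Cmult_comm (Cconj eta)), <- !Cmult_assoc, E; reflexivity.
Qed.

Lemma rotation_starlike (alpha : R) (eta : C) (f : C -> C) :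
  0 <= alpha < 1 -> is_rotation alpha eta f -> S_Lh_star alpha f.
Proof.
  intros Halpha Hrot; split; [split; [|split]|].
  - now apply (rotation_log_harmonic alpha eta).
  - now apply (rotation_univalent alpha eta).
  - do 4 eexists; exact (rotation_rep alpha eta f Hrot).
  - set (A := rotation_log alpha 1 eta).
    set (B := rotation_log alpha (- (1 - 2 * alpha)) eta).
    assert (Hfac : forall z, in_disk z -> f z = (z * Cexp (A z) * Cconj (Cexp (B z)))%C)
      by (intros z Hz; now apply rotation_factor).
    destruct Hrot as [Heta Hf].
    intros z Hz Z0.
    destruct (derivative_series _ A z (rotation_sums alpha 1 eta Heta) Hz) as [A' [WA SA]].
    destruct (derivative_series _ B z (rotation_sums alpha _ eta Heta) Hz) as [B' [WB SB]].
    rewrite (angular_quotient f A B z A' B' Hz Z0 Hfac WA WB).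
    assert (Hw := in_disk_rotation eta z Heta Hz).
    rewrite (angular_relation alpha eta z _ _ Hw SA SB).
    assert (H := Re_half_plane _ Hw).
    destruct Re_coordinate as [_ [_ L]]; rewrite L; nra.
Qed.

Lemma rotation_equality (alpha : R) (eta : C) (f h g : C -> C) (a b : nat -> C) (n : nat) :
  0 <= alpha < 1 -> is_rotation alpha eta f ->
  log_harmonic_rep f h g a b -> (1 <= n)%nat ->
  Cmod (a n - b n)%C = 2 * (1 - alpha) / INR n.
Proof.
  intros Halpha Hrot H Hn.
  rewrite (coefficient_difference_unique _ _ _ _ _ _ _ _ _ n H (rotation_rep _ _ _ Hrot) Hn).
  destruct Hrot as [Heta _].
  assert (N0 : 0 < INR n) by (apply lt_0_INR; lia).
  assert (N1 : RtoC (INR n) <> RtoC 0) by (apply RtoC_neq_0; lra).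
  replace (_ - _)%C with (RtoC (2 * (1 - alpha) / INR n) * eta ^ n)%C.
  - rewrite Cmod_mult, Cmod_pow, Heta, pow1, Cmod_R, Rabs_pos_eq; [ring|].
    apply Rdiv_le_0_compat; lra.
  - unfold rotation_coeff; rewrite RtoC_div by lra.
    rewrite RtoC_opp, RtoC_minus, !RtoC_mult, RtoC_minus; field; auto.
Qed.
Theorem theorem3p2 (alpha : R) (Halpha : 0 <= alpha < 1) :
  (forall (f h g : C -> C) (a b : nat -> C),
     S_Lh_star alpha f -> log_harmonic_rep f h g a b ->
     forall n : nat, (1 <= n)%nat ->
       Cmod (a n - b n)%C <= 2 * (1 - alpha) / INR n) /\
  (forall f : C -> C, extremal_or_rotation alpha f ->
     S_Lh_star alpha f /\
     forall (h g : C -> C) (a b : nat -> C), log_harmonic_rep f h g a b ->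
     forall n : nat, (1 <= n)%nat ->
       Cmod (a n - b n)%C = 2 * (1 - alpha) / INR n).
Proof.
  split.
  - intros f h g a b Hs Hrep n Hn; exact (starlike_coefficient_bound _ f h g a b n Hs Hrep Hn).
  - intros f Hf.
    assert (R : exists eta, is_rotation alpha eta f).
    { destruct Hf as [Hf|[eta [He Hr]]]; [|now exists eta].
      exists (RtoC 1); split; [apply Cmod_1|].
      intros z Hz; rewrite Hf, Cmult_1_l by auto.
      rewrite Cconj_RtoC; ring. }
    destruct R as [eta Hrot]; split.
    + now apply (rotation_starlike alpha eta).
    + intros h g a b Hrep n Hn.
      now apply (rotation_equality alpha eta f h g).
Qed.
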